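(* Let $p\ge2$, fix $n\ge2$, and let $\boldsymbol{X}_1,\dots,\boldsymbol{X}_n$ be iid on $\mathcal{S}^{p-1}$. For $\lambda>0$ let $$T_n(\lambda)=n\Big\|\frac1n\sum_{j=1}^n\Delta_{\mathcal{S}^{p-1}}e^{\lambda\boldsymbol{t}^\top\boldsymbol{X}_j}\Big\|^2_{L^2(\mathcal{S}^{p-1})}.$$ As $\lambda\to0$ or $\lambda\to\infty$, the rejection rule based on $T_n(\lambda)$ is asymptotically equivalent to 1. the Rayleigh test for $\lambda\to0$, since $$\lim_{\lambda\to0}\lambda^{-2}T_n(\lambda)\propto\frac1n\sum_{i,j=1}^n\boldsymbol{X}_i^\top\boldsymbol{X}_j;$$ 2. the test of Cai et al. (2013) for $\lambda\to\infty$, since, for $D_n(\lambda):=\frac1n\sum_{j=1}^n\big\|\Delta_{\mathcal{S}^{p-1}}e^{\lambda\boldsymbol{t}^\top\boldsymbol{X}_j}\big\|^2_{L^2(\mathcal{S}^{p-1})}$, $$\lim_{\lambda\to\infty}\lambda^{-1}\log\big(T_n(\lambda)-D_n(\lambda)\big)=\max_{1\le i<j\le n}\|\boldsymbol{X}_i+\boldsymbol{X}_j\|.$$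
   Context: $\mathcal{S}^{p-1}$ is the unit sphere in $\mathbb{R}^p$, $\nu_{p-1}$ the uniform probability measure on it, and $L^2(\mathcal{S}^{p-1})$ has inner product $\langle h,k\rangle=\int_{\mathcal{S}^{p-1}}hk\,\mathrm{d}\nu_{p-1}$. $\Delta_{\mathcal{S}^{p-1}}$ is the Laplace--Beltrami operator; $\Delta_{\mathcal{S}^{p-1}}e^{\lambda\boldsymbol{t}^\top\boldsymbol{X}_j}$ is it applied to $\boldsymbol{x}\mapsto e^{\lambda\boldsymbol{t}^\top\boldsymbol{x}}$ and evaluated at $\boldsymbol{X}_j$ (equivalently, applied in $\boldsymbol{t}$), and the norms are taken in the variable $\boldsymbol{t}\in\mathcal{S}^{p-1}$. $T_n(\lambda)$ is a statistic for testing uniformity on $\mathcal{S}^{p-1}$, rejecting for large values. The symbol $\propto$ means equality up to a multiplicative constant. The Rayleigh test of uniformity rejects for large values of $\frac1n\sum_{i,j=1}^n\boldsymbol{X}_i^\top\boldsymbol{X}_j$; the test of Cai et al. (2013) is the one based on $\max_{i<j}\boldsymbol{X}_i^\top\boldsymbol{X}_j$, and $\|\boldsymbol{X}_i+\boldsymbol{X}_j\|=\sqrt{2+2\boldsymbol{X}_i^\top\boldsymbol{X}_j}$. *)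

(* Defs.v *)
From HB Require Import structures.
From mathcomp Require Import all_boot all_order all_algebra.
From mathcomp Require Import all_classical all_reals all_analysis.

Set Implicit Arguments.
Unset Strict Implicit.
Unset Printing Implicit Defensive.

Import Order.TTheory GRing.Theory Num.Theory.
Import numFieldNormedType.Exports.

Local Open Scope classical_set_scope.
Local Open Scope ring_scope.

(** R^p is ['rV[R]_p].  The norm the library puts on matrices is the sup norm
    (it induces the usual topology and derivatives); the Euclidean norm is
    [enorm] below. *)

Definition dotp (R : realType) (p : nat) (x y : 'rV[R]_p) : R :=
  \sum_(i < p) x 0 i * y 0 i.

Definition enorm (R : realType) (p : nat) (x : 'rV[R]_p) : R :=
  Num.sqrt (dotp x x).

Definition sphere (R : realType) (p : nat) : set 'rV[R]_p :=
  [set x | enorm x = 1].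
Arguments sphere : clear implicits.

(** R^p with its Borel sigma-algebra. *)
Notation borel_rV R p := (g_sigma_algebraType (@open 'rV[R]_p)).

(** The uniform distribution on the sphere is the unique Borel probability
    measure that is carried by the sphere and invariant under O(p). *)
Definition uniform_on_sphere (R : realType) (p : nat)
    (nu : probability (borel_rV R p) R) : Prop :=
  nu (sphere R p) = 1%E /\
  forall (O : 'M[R]_p) (A : set (borel_rV R p)),
    O *m O^T = 1%:M -> measurable A ->
    nu ((fun x : 'rV[R]_p => x *m O) @^-1` A) = nu A.

Definition L2_inner (R : realType) (p : nat)
    (nu : probability (borel_rV R p) R) (h k : 'rV[R]_p -> R) : R :=
  (\int[nu]_(t in (sphere R p : set (borel_rV R p))) (h t * k t))%R.

Definition L2_norm (R : realType) (p : nat)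
    (nu : probability (borel_rV R p) R) (h : 'rV[R]_p -> R) : R :=
  Num.sqrt (L2_inner nu h h).

Definition laplacian (R : realType) (p : nat) (f : 'rV[R]_p -> R)
    (x : 'rV[R]_p) : R :=
  \sum_(i < p)
    'D_(delta_mx 0 i) (fun y : 'rV[R]_p => 'D_(delta_mx 0 i) f y) x.

(** Laplace-Beltrami operator of the unit sphere: the Euclidean Laplacian of
    the extension of [f] that is constant along rays, evaluated at a point [x]
    of the sphere.  Only the values of [f] on the sphere matter. *)
Definition laplace_beltrami (R : realType) (p : nat) (f : 'rV[R]_p -> R)
    (x : 'rV[R]_p) : R :=
  laplacian (fun y : 'rV[R]_p => f ((enorm y)^-1 *: y)) x.

Definition lap_exp (R : realType) (p : nat) (l : R) (x t : 'rV[R]_p) : R :=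
  laplace_beltrami (fun y : 'rV[R]_p => expR (l * dotp t y)) x.

Definition T_stat (R : realType) (p n : nat)
    (nu : probability (borel_rV R p) R) (l : R) (x : 'I_n -> 'rV[R]_p) : R :=
  n%:R *
  L2_norm nu (fun t => n%:R^-1 * \sum_(j < n) lap_exp l (x j) t) ^+ 2.

Definition D_stat (R : realType) (p n : nat)
    (nu : probability (borel_rV R p) R) (l : R) (x : 'I_n -> 'rV[R]_p) : R :=
  n%:R^-1 * \sum_(j < n) L2_norm nu (lap_exp l (x j)) ^+ 2.

Definition rayleigh_stat (R : realType) (p n : nat) (x : 'I_n -> 'rV[R]_p) : R :=
  n%:R^-1 * \sum_(i < n) \sum_(j < n) dotp (x i) (x j).

(** The default value -1 is a lower bound of all inner products of unit vectors,
    so on the sphere (with at least two points) this is the maximum. *)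
Definition cai_stat (R : realType) (p n : nat) (x : 'I_n -> 'rV[R]_p) : R :=
  \big[Num.max/(-1)]_(ij : 'I_n * 'I_n | (ij.1 < ij.2)%N)
     dotp (x ij.1) (x ij.2).

(** Likewise with default value 0, since norms are nonnegative. *)
Definition max_norm_sum (R : realType) (p n : nat) (x : 'I_n -> 'rV[R]_p) : R :=
  \big[Num.max/0]_(ij : 'I_n * 'I_n | (ij.1 < ij.2)%N)
     enorm (x ij.1 + x ij.2).

(** [X] is an iid sample, under [P], of random vectors of the unit sphere. *)
Definition iid_on_sphere (R : realType) (p n : nat) (d : measure_display)
    (Omega : measurableType d) (P : probability Omega R)
    (X : 'I_n -> {RV P >-> borel_rV R p}) : Prop :=
  [/\ forall j w, sphere R p (X j w),
      forall i j (A : set (borel_rV R p)), measurable A ->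
        distribution P (X i) A = distribution P (X j) A
    & forall (J : {set 'I_n}) (A : 'I_n -> set (borel_rV R p)),
        (forall j, measurable (A j)) ->
        P (\bigcap_(j in [set` J]) (X j @^-1` A j)) =
        (\prod_(j in J) P (X j @^-1` A j))%E].

(** Asymptotic equivalence, as the parameter [l] follows the filter [F], of the
    test rejecting for large values of [T l] and the one rejecting for large
    values of [S].  Every critical value [k] of [S] is matched by critical
    values [kT l] of [T l], not depending on the sample, for which both tests
    eventually take the same decision on each sample of [n] points of the sphere
    off the boundary [S = k] of the limiting rejection region. *)
Definition rejection_equiv (R : realType) (p n : nat) (F : set_system R)
    (T : R -> ('I_n -> 'rV[R]_p) -> R) (S : ('I_n -> 'rV[R]_p) -> R) : Prop :=
  forall k : R, exists kT : R -> R,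
    forall x : 'I_n -> 'rV[R]_p, (forall j, sphere R p (x j)) -> S x <> k ->
      \forall l \near F, (kT l < T l x) = (k < S x).

(* Main.v *)
(** A function of [s = t . x] has a spherical Laplacian depending on [s] only: with
    [d = p - 1], that of [e^(l s)] is [g l s = e^(l s) (l^2 (1 - s^2) - d l s)].  Hence
    [T_n = n^-1 sum_ij K(X_i, X_j)] for [K(x, y)] the mean of [g l (t . x) g l (t . y)]
    over [t], and [D_n = K(e, e)] does not depend on the sample, by invariance.

    For [l -> 0], [g l s = - d l s + O(l^2)], and the mean of [(t . x) (t . y)] is
    [x . y / p] by invariance.

    For [l -> oo], [K(x, y)] grows like [e^(l |x + y|)] by Laplace's method.  The
    integrand is negative only within [O(l^(-1/2))] of [x] or [y], and there its
    exponent is about [l |x + y|^2 / 2], smaller than [l |x + y|] unless [x = y] or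
    [x = - y], two cases where the negative part is harmless for other reasons. *)
Require Import Defs.
From HB Require Import structures.
From mathcomp Require Import all_boot all_order all_algebra.
From mathcomp Require Import all_classical all_reals all_analysis.
From mathcomp Require Import measurable_realfun.
From mathcomp Require Import ring lra.
Import Order.TTheory GRing.Theory Num.Theory.
Import numFieldNormedType.Exports.
Local Open Scope classical_set_scope.
Local Open Scope ring_scope.

Set Implicit Arguments.
Unset Strict Implicit.
Unset Printing Implicit Defensive.

(** * Pointwise algebra of continuous real-valued functions *)

Lemma continuous_sumr {R : realType} {T : topologicalType} {I : Type}
    (r : seq I) (F : I -> T -> R) :
  (forall i, continuous (F i)) -> continuous (fun t => \sum_(i <- r) F i t).
Proof.
move=> cF t; apply: cvg_big; first by move=> ?; exact: add_continuous.
by move=> i _; exact: cF.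
Qed.

Lemma continuous_mulr {R : realType} {T : topologicalType} (f g : T -> R) :
  continuous f -> continuous g -> continuous (fun t => f t * g t).
Proof. by move=> cf cg t; apply: cvgM; [exact: cf|exact: cg]. Qed.

Lemma continuous_addr {R : realType} {T : topologicalType} (f g : T -> R) :
  continuous f -> continuous g -> continuous (fun t => f t + g t).
Proof. by move=> cf cg t; apply: cvgD; [exact: cf|exact: cg]. Qed.

Lemma continuous_subr {R : realType} {T : topologicalType} (f g : T -> R) :
  continuous f -> continuous g -> continuous (fun t => f t - g t).
Proof. by move=> cf cg t; apply: cvgB; [exact: cf|exact: cg]. Qed.

(** * The Euclidean inner product and the unit sphere *)

Section EuclideanSpace.
Context {R : realType} {p : nat}.
Implicit Types x y z t : 'rV[R]_p.

Lemma dotp_mulmx x y : dotp x y = (x *m y^T) 0 0.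
Proof. by rewrite mxE; apply: eq_bigr => i _; rewrite mxE. Qed.

Lemma dotpC x y : dotp x y = dotp y x.
Proof. by apply: eq_bigr => i _; rewrite mulrC. Qed.

Lemma dotpDl x y z : dotp (x + y) z = dotp x z + dotp y z.
Proof. by rewrite !dotp_mulmx mulmxDl mxE. Qed.

Lemma dotpDr x y z : dotp z (x + y) = dotp z x + dotp z y.
Proof. by rewrite dotpC dotpDl !(dotpC z). Qed.

Lemma dotpZl (a : R) x y : dotp (a *: x) y = a * dotp x y.
Proof. by rewrite !dotp_mulmx -scalemxAl mxE. Qed.

Lemma dotpZr (a : R) x y : dotp x (a *: y) = a * dotp x y.
Proof. by rewrite dotpC dotpZl dotpC. Qed.

Lemma dotpNl x y : dotp (- x) y = - dotp x y.
Proof. by rewrite -scaleN1r dotpZl mulN1r. Qed.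

Lemma dotpNr x y : dotp x (- y) = - dotp x y.
Proof. by rewrite dotpC dotpNl dotpC. Qed.

Definition dotpE := (dotpDl, dotpDr, dotpZl, dotpZr, dotpNl, dotpNr).

Lemma dotp_mxl (O : 'M[R]_p) x y : dotp (x *m O) y = dotp x (y *m O^T).
Proof. by rewrite !dotp_mulmx trmx_mul trmxK mulmxA. Qed.

Lemma dotp_delta x i : dotp x (delta_mx 0 i) = x 0 i.
Proof.
rewrite /dotp (bigD1 i)//= big1 ?addr0 => [|j ji]; rewrite mxE eqxx /=.
  by rewrite eqxx mulr1.
by rewrite (negbTE ji) mulr0.
Qed.

Lemma dotp_ge0 x : 0 <= dotp x x.
Proof. by apply: sumr_ge0 => i _; rewrite -expr2 sqr_ge0. Qed.

Lemma dotp_eq0 x : (dotp x x == 0) = (x == 0).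
Proof.
apply/eqP/eqP => [x0|->]; last by rewrite /dotp big1// => i _; rewrite mxE mul0r.
apply/rowP => i; rewrite mxE; apply/eqP; rewrite -sqrf_eq0 expr2; apply/eqP.
by apply: (psumr_eq0P _ x0) => // j _; rewrite -expr2 sqr_ge0.
Qed.

Lemma dotp_gt0 x : (0 < dotp x x) = (x != 0).
Proof. by rewrite lt_def dotp_eq0 dotp_ge0 andbT. Qed.

(** Nonnegativity of the squared norm of [dotp y y *: x - dotp x y *: y], divided by [dotp y y] when
    [y] is nonzero. *)
Lemma dotp_CS x y : dotp x y ^+ 2 <= dotp x x * dotp y y.
Proof.
have [->|y0] := eqVneq y 0.
  by rewrite -(scale0r 0) !dotpE !mul0r expr0n mulr0.
have yy : 0 < dotp y y by rewrite dotp_gt0.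
have := dotp_ge0 (dotp y y *: x - dotp x y *: y).
rewrite !dotpE (dotpC y x) => H.
rewrite -subr_ge0 -(pmulr_rge0 _ yy); apply: le_trans H _.
by rewrite le_eqVlt; apply/orP; left; apply/eqP; ring.
Qed.

Lemma sphereP x : sphere R p x <-> dotp x x = 1.
Proof.
rewrite /sphere /= /enorm; split => [|->]; last exact: sqrtr1.
by move=> /(congr1 (fun a => a ^+ 2)); rewrite sqr_sqrtr ?dotp_ge0// expr1n.
Qed.

Lemma sqr_enorm x : enorm x ^+ 2 = dotp x x.
Proof. by rewrite sqr_sqrtr// dotp_ge0. Qed.

Lemma dotp_le_enorm t z : sphere R p t -> dotp t z <= enorm z.
Proof.
move=> /sphereP tt; apply: le_trans (ler_norm _) _.
rewrite -sqrtr_sqr ler_wsqrtr//.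
by apply: le_trans (dotp_CS _ _) _; rewrite tt mul1r.
Qed.

Lemma dotp_sphere_sqr_le1 t x :
  sphere R p t -> sphere R p x -> dotp t x ^+ 2 <= 1.
Proof.
by move=> /sphereP tt /sphereP xx; apply: le_trans (dotp_CS _ _) _; rewrite tt xx mulr1.
Qed.

Lemma dotp_sphere_norm_le1 t x :
  sphere R p t -> sphere R p x -> `|dotp t x| <= 1.
Proof.
by move=> tS xS; rewrite -sqrtr_sqr -[leRHS]sqrtr1 ler_wsqrtr// dotp_sphere_sqr_le1.
Qed.

Lemma sphere_eq x y : sphere R p x -> sphere R p y -> dotp x y = 1 -> x = y.
Proof.
move=> /sphereP xx /sphereP yy xy; apply/eqP; rewrite -subr_eq0 -dotp_eq0.
by rewrite !dotpE xx yy (dotpC y) xy; apply/eqP; ring.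
Qed.

Lemma continuous_dotp x : continuous (fun t : 'rV[R]_p => dotp t x).
Proof.
apply: continuous_sumr => i; apply: continuous_mulr;
  first by move=> t; apply: coord_continuous.
by move=> t; exact: cst_continuous.
Qed.

Lemma continuous_dotpp : continuous (fun t : 'rV[R]_p => dotp t t).
Proof.
by apply: continuous_sumr => i; apply: continuous_mulr => t; apply: coord_continuous.
Qed.

End EuclideanSpace.

(** * The Laplacian of an exponential on the sphere *)

(** Both sides are limits of the same difference quotient. This turns the iterated partial
    derivatives of the Laplacian into one-variable calculus. *)
Lemma derive_line {R : realType} (V W : normedModType R) (f : V -> W) (x v : V)
    (h : R) :
  'D_v f (h *: v + x) = 'D_1 (fun s : R => f (s *: v + x)) h.
Proof.
rewrite /derive; do 2 f_equal; apply/funext => s /=.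
by rewrite addrA -scalerDl [s *: 1]mulr1.
Qed.

Lemma laplacian_line {R : realType} {p : nat} (f : 'rV[R]_p -> R) x :
  laplacian f x = \sum_(i < p)
    'D_(1 : R) ('D_(1 : R) (fun h : R => f (h *: delta_mx 0 i + x))) 0.
Proof.
apply: eq_bigr => i _.
rewrite -[X in 'D__ _ X = _](add0r x) -[X in 'D__ _ (X + x)](scale0r (delta_mx 0 i))
  derive_line.
by congr ('D_(1 : R) _ 0); apply/funext => s; rewrite derive_line.
Qed.

Section RayExponential.
Context {R : realType} (l a b c q : R).
(** Restriction of [y |-> expR (l * (t . y) / |y|)] to the line [y = x + h e_i], with [a = t_i],
    [b = t . x], [c = x_i] and [q = x . x]. Then [Q] is the squared norm of [y], [r] its norm, [N]
    is [t . y], and [phi1] is the derivative of [phi]. *)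
Let Q (h : R) : R := q + 2 * c * h + h ^+ 2.
Let N (h : R) : R := b + a * h.
Let r (h : R) : R := Num.sqrt (Q h).
Let phi (h : R) : R := expR (l * (N h / r h)).
Let phi1 (h : R) : R := phi h * (l * (a / r h - N h * (c + h) / r h ^+ 3)).

Let is_derive_N h : is_derive h (1 : R) N a.
Proof. by rewrite /N; apply: is_derive_eq; rewrite /GRing.scale /=; ring. Qed.

Let is_derive_Q h : is_derive h (1 : R) Q (2 * (c + h)).
Proof. by rewrite /Q; apply: is_derive_eq; rewrite /GRing.scale /=; ring. Qed.

Let is_derive_r h : 0 < Q h -> is_derive h (1 : R) r ((c + h) / r h).
Proof.
move=> Q0.
have sQ : r h != 0 by rewrite gt_eqF// sqrtr_gt0.
have H := @is_derive1_comp _ Num.sqrt Q h _ _ (is_derive1_sqrt Q0) (is_derive_Q h).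
apply: (is_derive_eq H).
rewrite -/(r h); field.
exact: sQ.
Qed.

Let is_derive_phi h : 0 < Q h -> is_derive h (1 : R) phi (phi1 h).
Proof.
move=> Q0.
have sQ : r h != 0 by rewrite gt_eqF// sqrtr_gt0.
have dr := is_derive_r Q0.
have dV := is_deriveV sQ dr.
have dM := is_deriveM (is_derive_N h) dV.
have dZ := is_deriveZ l dM.
have H := @is_derive1_comp _ expR _ h _ _ (is_derive_expR _) dZ.
apply: (is_derive_eq H).
rewrite /phi1 /phi /= /GRing.scale /=; field.
exact: sQ.
Qed.

Lemma derive2_ray_exp : q = 1 ->
  'D_(1 : R) ('D_(1 : R) phi) 0 =
  expR (l * b) * ((l * (a - b * c)) ^+ 2
                  + l * (3 * b * c ^+ 2 - b - 2 * a * c)).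
Proof.
move=> q1.
have Q01 : Q 0 = 1 by rewrite /Q q1; ring.
have Q0 : 0 < Q 0 by rewrite Q01.
have cQ : {for (0 : R), continuous Q}.
  apply: differentiable_continuous; apply/derivable1_diffP.
  by case: (is_derive_Q 0).
have nearQ : \forall h \near (0 : R), 0 < Q h.
  exact: (cvgr_gt _ cQ).
have r0 : r 0 = 1 by rewrite /r Q01 sqrtr1.
have rn0 : r 0 != 0 by rewrite r0 oner_eq0.
(* The formula [phi1] holds only where [Q] is positive, which is the case near 0; a derivative at 0
   sees no more than that. *)
rewrite (@near_eq_derive _ _ _ _ phi1); first last.
  by near=> h; apply: derive_val; apply: is_derive_phi; near: h.
have dr := is_derive_r Q0.
have dV := is_deriveV rn0 dr.
have rn3 : (r ^+ 3) 0 != 0 by rewrite fctE r0 expr1n oner_eq0.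
have dV3 := is_deriveV rn3 (is_deriveX 3 dr).
have dc : is_derive (0 : R) (1 : R) (fun h => c + h) 1.
  apply: (is_derive_eq (is_deriveD (is_derive_cst c 0 (1 : R))
    (is_derive_id 0 (1 : R)))).
  by rewrite add0r.
have d1 := is_deriveM (is_derive_cst a 0 (1 : R)) dV.
have d2 := is_deriveM (is_deriveM (is_derive_N 0) dc) dV3.
have d3 := is_deriveZ l (is_deriveB d1 d2).
have H := is_deriveM (is_derive_phi Q0) d3.
rewrite (@derive_val _ _ _ _ _ _ _ H).
rewrite /phi1 /phi /= !fctE /= /GRing.scale /= r0 /N.
rewrite !(mulr0, addr0, invr1, mulr1, expr1n).
ring.
Unshelve. all: by end_near.
Qed.

End RayExponential.

(** The factor of the spherical Laplacian that carries its sign: on functions of [s = t . x] the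
    operator is [(1 - s^2) f'' - d s f'], applied here to [f = e^(l s)]. *)
Definition zonal_poly {R : realType} (d l s : R) : R :=
  l ^+ 2 * (1 - s ^+ 2) - d * l * s.

Definition zonal_lap {R : realType} (d l s : R) : R :=
  expR (l * s) * zonal_poly d l s.

(** The second derivatives along the coordinates add up through [sum t_i^2 = sum x_i^2 = 1] and
    [sum t_i x_i = s]. The summand [- l s], free of [i], occurs [p] times, whence the coefficient
    [p - 1]. *)
Lemma lap_expE {R : realType} {p : nat} (l : R) (x t : 'rV[R]_p) :
  sphere R p x -> sphere R p t ->
  lap_exp l x t = zonal_lap (p%:R - 1) l (dotp t x).
Proof.
move=> /sphereP xx /sphereP tt.
rewrite /lap_exp /laplace_beltrami laplacian_line.
under eq_bigr => i _.
  rewrite (_ : (fun h : R => _) = (fun h : R => expR (l *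
      ((dotp t x + t 0 i * h) / Num.sqrt (dotp x x + 2 * x 0 i * h + h ^+ 2))))); last first.
    apply/funext => h; rewrite dotpZr dotpDr dotpZr dotp_delta /enorm; congr expR.
    congr (l * _); rewrite mulrC; congr (_ / Num.sqrt _); first by ring.
    rewrite !dotpE (dotpC (delta_mx 0 i) x) !dotp_delta mxE !eqxx /=; ring.
  rewrite derive2_ray_exp//.
  over.
rewrite -mulr_sumr; congr (_ * _); rewrite /zonal_poly.
set s := dotp t x.
rewrite (eq_bigr (fun i => l ^+ 2 * (t 0 i * t 0 i)
   + (- 2 * l ^+ 2 * s - 2 * l) * (t 0 i * x 0 i)
   + (l ^+ 2 * s ^+ 2 + 3 * l * s) * (x 0 i * x 0 i) - l * s)); last by move=> i _; ring.
rewrite !big_split /= -!mulr_sumr -!/(dotp _ _) tt xx -/s.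
rewrite sumrN sumr_const card_ord -mulr_natr.
ring.
Qed.

(** * Means over the sphere *)

Definition sphere_mean {R : realType} {p : nat}
    (nu : probability (borel_rV R p) R) (f : 'rV[R]_p -> R) : R :=
  (\int[nu]_(t in (sphere R p : set (borel_rV R p))) f t)%R.

Section SphereTopology.
Context {R : realType} {p : nat}.

Lemma closed_sphere : closed (sphere R p).
Proof.
rewrite (_ : sphere R p = (fun x => dotp x x) @^-1` [set 1]); last first.
  by apply/seteqP; split => x /sphereP.
apply: preimage_closed; last exact: closed_eq.
by move=> x _; exact: continuous_dotpp.
Qed.

(** Closed and bounded: each coordinate is at most the Euclidean norm, so the sup norm is at most
    1. *)
Lemma compact_sphere : compact (sphere R p).
Proof.
apply: bounded_closed_compact; last exact: closed_sphere.
exists 1; split=> // M M1 x /sphereP xx /=; apply: le_trans (ltW M1).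
rewrite [leLHS]/Num.norm /= mx_normrE; apply: bigmax_le => //= -[i j] _ /=.
rewrite (ord1 i) -sqrtr_sqr -[leRHS]sqrtr1 ler_wsqrtr// -xx /dotp (bigD1 j)//=.
by rewrite expr2 lerDl sumr_ge0// => k _; rewrite -expr2 sqr_ge0.
Qed.

Lemma measurable_sphere : measurable (sphere R p : set (borel_rV R p)).
Proof.
rewrite -[sphere R p]setCK; apply: (@measurableC _ (borel_rV R p)).
by apply: sub_sigma_algebra; exact/closed_openC/closed_sphere.
Qed.

Lemma continuous_borel_measurable (f : 'rV[R]_p -> R) :
  continuous f -> measurable_fun (setT : set (borel_rV R p)) f.
Proof.
move=> cf; apply: (@measurability _ _ (borel_rV R p) _ setT f _
  (RGenOpens.measurableE R)).
move=> _ [_ [a [b ->]] <-]; rewrite setTI; apply: sub_sigma_algebra.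
by move/continuousP: cf; apply; exact: itv_open.
Qed.

Lemma continuous_rV (T : topologicalType) (F : T -> 'rV[R]_p) :
  (forall j, continuous (fun t => F t 0 j)) -> continuous F.
Proof.
move=> cF x; apply/cvg_ballP => e e0.
have coord i j : \forall y \near x, ball (F x i j) e (F y i j).
  by rewrite (ord1 i); have /cvg_ballP := cF j x; apply.
apply: filterS (filter_forall _ (fun i => filter_forall _ (coord i))) => y.
by split.
Qed.

Lemma continuous_mulmx (O : 'M[R]_p) : continuous (fun x : 'rV[R]_p => x *m O).
Proof.
apply: continuous_rV => j.
rewrite (_ : (fun _ => _) = fun t => dotp t (col j O)^T).
  exact: continuous_dotp.
by apply/funext => t; rewrite mxE; apply: eq_bigr => k _; rewrite !mxE.
Qed.

End SphereTopology.

Section SphereMean.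
Context {R : realType} {p : nat} {nu : probability (borel_rV R p) R}.
Hypothesis hnu : uniform_on_sphere nu.
Local Notation mean := (sphere_mean nu).
Implicit Types f g : 'rV[R]_p -> R.

(** A continuous function is bounded on the compact sphere, and the measure is finite. *)
Lemma sphere_integrable f : continuous f ->
  nu.-integrable (sphere R p : set (borel_rV R p)) (EFin \o f).
Proof.
move=> cf; apply: measurable_bounded_integrable.
- exact: measurable_sphere.
- exact: (le_lt_trans (probability_le1 _ measurable_sphere) (ltry 1)).
- exact: measurable_funTS (continuous_borel_measurable cf).
have/compact_bounded := continuous_compact (continuous_subspaceT cf) compact_sphere.
move=> [M [Mr HM]]; exists M; split => // y /HM H x Sx.
by apply: H; exists x.
Qed.

Lemma sphere_mean_cst (c : R) : mean (fun=> c) = c.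
Proof.
rewrite /sphere_mean Rintegral_cst; last exact: measurable_sphere.
by rewrite -[RHS]mulr1; congr (c * _); exact: (congr1 fine (proj1 hnu)).
Qed.

Lemma sphere_meanD f g : continuous f -> continuous g ->
  mean (fun t => f t + g t) = mean f + mean g.
Proof.
by move=> cf cg; apply: RintegralD;
  [exact: measurable_sphere|exact: sphere_integrable..].
Qed.

Lemma sphere_meanZ (a : R) f : continuous f ->
  mean (fun t => a * f t) = a * mean f.
Proof.
by move=> cf; apply: RintegralZl; [exact: measurable_sphere|exact: sphere_integrable].
Qed.

Lemma sphere_mean_sum (I : Type) (r : seq I) (F : I -> 'rV[R]_p -> R) :
  (forall i, continuous (F i)) ->
  mean (fun t => \sum_(i <- r) F i t) = \sum_(i <- r) mean (F i).
Proof.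
move=> cF; elim: r => [|i r IH].
  rewrite big_nil -[RHS](sphere_mean_cst 0); congr mean.
  by apply/funext => t; rewrite big_nil.
rewrite big_cons -IH -sphere_meanD//.
  by congr mean; apply/funext => t; rewrite big_cons.
exact: continuous_sumr.
Qed.

Lemma eq_sphere_mean f g : (forall t, sphere R p t -> f t = g t) ->
  mean f = mean g.
Proof. by move=> fg; apply: eq_Rintegral => t /set_mem; exact: fg. Qed.

Lemma le_sphere_mean f g : continuous f -> continuous g ->
  (forall t, sphere R p t -> f t <= g t) -> mean f <= mean g.
Proof.
by move=> cf cg fg; apply: le_Rintegral => //;
  [exact: measurable_sphere|exact: sphere_integrable..].
Qed.

Lemma sphere_mulmx (O : 'M[R]_p) t : O *m O^T = 1%:M ->
  sphere R p (t *m O) <-> sphere R p t.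
Proof. by move=> OO; rewrite !sphereP dotp_mxl -mulmxA OO mulmx1. Qed.

(** Change of variables: the pushforward of [nu] by an orthogonal map is [nu], and the sphere is its
    own preimage. *)
Lemma sphere_mean_mulmx (O : 'M[R]_p) f : O *m O^T = 1%:M -> continuous f ->
  mean (fun t => f (t *m O)) = mean f.
Proof.
move=> OO cf; rewrite /sphere_mean /Rintegral; congr fine.
pose phi (x : borel_rV R p) : borel_rV R p := x *m O.
have mphi : measurable_fun setT phi.
  apply: (@measurability _ _ (borel_rV R p) (borel_rV R p) setT phi
    (@open 'rV[R]_p)) => //.
  move=> _ [A oA <-]; rewrite setTI; apply: sub_sigma_algebra.
  by have/continuousP := continuous_mulmx (O := O); apply.
have pS : phi @^-1` (sphere R p : set (borel_rV R p)) = sphere R p.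
  by apply/seteqP; split => x /(sphere_mulmx _ OO).
have H := @integral_pushforward _ _ _ _ _ _ mphi nu
  (sphere R p : set (borel_rV R p)) (EFin \o f).
rewrite pS in H; rewrite -H.
- by apply: eq_measure_integral => A mA _; rewrite /pushforward; apply: (proj2 hnu).
- by apply/measurable_EFinP; apply: continuous_borel_measurable.
- have cfO : continuous (f \o (fun x : 'rV[R]_p => x *m O)).
    by move=> t; apply: continuous_comp; [exact: continuous_mulmx|exact: cf].
  exact: (sphere_integrable cfO).
- exact: measurable_sphere.
Qed.

End SphereMean.

(** * Transitivity of the orthogonal group and its consequences for means *)

Section SphereSymmetry.
Context {R : realType} {p : nat}.
Implicit Types x y t : 'rV[R]_p.

Lemma sphere_transitive x y : sphere R p x -> sphere R p y ->
  exists2 U : 'M[R]_p, U *m U^T = 1%:M & x *m U = y.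
Proof.
move=> /sphereP xx /sphereP yy.
have [->|xy] := eqVneq x y; first by exists 1%:M; rewrite ?trmx1 mulmx1.
pose w := x - y; pose k := 2 / dotp w w.
have w0 : dotp w w != 0 by rewrite dotp_eq0 subr_eq0.
have wwE : dotp w w = 2 * (1 - dotp x y).
  by rewrite !dotpE xx yy (dotpC y x); ring.
have ww : w *m w^T = (dotp w w)%:M.
  by rewrite [LHS]mx11_scalar -dotp_mulmx.
(* [1 - k H] is the reflection that exchanges [x] and [y]. *)
pose H := w^T *m w.
have HT : H^T = H by rewrite trmx_mul trmxK.
have HH : H *m H = dotp w w *: H.
  by rewrite /H mulmxA -(mulmxA w^T) ww mul_mx_scalar scalemxAl.
exists (1%:M - k *: H).
  rewrite [(_ - _)^T]raddfB /= trmx1 [(k *: H)^T]linearZ /= HT.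
  rewrite mulmxBl mul1mx mulmxBr mulmx1 -scalemxAl -scalemxAr HH !scalerA.
  (* With [H *m H = dotp w w *: H], this makes the square of the symmetric matrix [1 - k H] the
     identity. *)
  have kk : k * k * dotp w w = 2 * k by rewrite /k; field.
  by rewrite kk; apply/matrixP => a b; rewrite !mxE; ring.
rewrite mulmxBr mulmx1 -scalemxAr /H mulmxA [x *m w^T]mx11_scalar -dotp_mulmx.
rewrite mul_scalar_mx scalerA.
have -> : k * dotp x w = 1.
  have : 1 - dotp x y != 0 by move: w0; rewrite wwE mulf_eq0 negb_or => /andP[].
  by rewrite /k [dotp x w]dotpDr dotpNr xx wwE => ?; field.
by rewrite scale1r opprB addrC subrK.
Qed.

End SphereSymmetry.

Section SphereMeanSymmetry.
Context {R : realType} {p : nat} {nu : probability (borel_rV R p) R}.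
Hypothesis hnu : uniform_on_sphere nu.
Local Notation mean := (sphere_mean nu).

(** By compactness finitely many rotated copies of [[set t | f t0 / 2 < f t]] cover
    the sphere, and [f] has the same mean on all of them. *)
Lemma sphere_mean_gt0 (f : 'rV[R]_p -> R) (t0 : 'rV[R]_p) :
  continuous f -> (forall t, sphere R p t -> 0 <= f t) ->
  sphere R p t0 -> 0 < f t0 -> 0 < mean f.
Proof.
move=> cf f0 St0 ft0.
have cfU (U : 'M[R]_p) : continuous (fun t : 'rV[R]_p => f (t *m U)).
  by move=> t; apply: continuous_comp; [exact: continuous_mulmx|exact: cf].
have := @compact_sphere R p; rewrite compact_cover.
move=> /(_ _ [set U : 'M[R]_p | U *m U^T = 1%:M]
           (fun U => [set t : 'rV[R]_p | f t0 / 2 < f (t *m U)])).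
case.
- move=> U _.
  rewrite (_ : [set t | _] =
      (fun t : 'rV[R]_p => f (t *m U)) @^-1` [set r | f t0 / 2 < r]).
    by move/continuousP : (cfU U); apply; exact: open_gt.
  by [].
- move=> t St; have [U UU tU] := sphere_transitive St St0.
  by exists U => //=; rewrite tU ltr_pdivrMr// ltr_pMr// ltr1n.
move=> D sD cov; pose s : seq 'M[R]_p := finmap.enum_fset D.
have {}sD U : U \in s -> U *m U^T = 1%:M by move=> /sD; rewrite inE.
rewrite lt_def; apply/andP; split; last exact: Rintegral_ge0.
apply/eqP => m0.
(* On the sphere the sum of the finitely many rotated copies is at least [f t0 / 2], yet each copy
   would have mean zero. *)
have : mean (fun=> f t0 / 2) <= mean (fun t => \sum_(U <- s) f (t *m U)).
  apply: le_sphere_mean => //; first exact: cst_continuous.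
    exact: continuous_sumr.
  move=> t St; have [U UD H] := cov _ St.
  apply: le_trans (ltW H) _; rewrite (big_rem U)//= lerDl.
  rewrite big_seq sumr_ge0// => U' /mem_rem U'D.
  by apply: f0; apply/sphere_mulmx => //; exact: sD.
rewrite (sphere_mean_cst hnu) (sphere_mean_sum hnu) // big_seq big1 => [|U UD].
  by rewrite leNgt divr_gt0.
by rewrite (sphere_mean_mulmx hnu)//; exact: sD.
Qed.

End SphereMeanSymmetry.

(** Invariance makes the quadratic form [Q z], the mean of [(t . z)^2], constant on the sphere;
    homogeneity gives [Q z = c |z|^2], and polarization the bilinear form. *)
Lemma sphere_second_moment {R : realType} {p : nat}
    {nu : probability (borel_rV R p) R} : uniform_on_sphere nu ->
  (0 < p)%N -> exists2 c : R, 0 < c &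
  forall x y, sphere_mean nu (fun t => dotp t x * dotp t y) = c * dotp x y.
Proof.
case: p nu => // q nu' hnu' _.
pose e : 'rV[R]_q.+1 := delta_mx 0 0.
have Se : sphere R q.+1 e by apply/sphereP; rewrite dotp_delta mxE !eqxx.
pose Q z := sphere_mean nu' (fun t => dotp t z * dotp t z).
have cdd z w : continuous (fun t : 'rV[R]_q.+1 => dotp t z * dotp t w).
  by apply: continuous_mulr; exact: continuous_dotp.
have QS z : sphere R q.+1 z -> Q z = Q e.
  move=> Sz; have [U UU zU] := sphere_transitive Se Sz.
  rewrite /Q -[RHS](sphere_mean_mulmx hnu' (O := U^T))//.
    by apply: eq_sphere_mean => t _; rewrite -zU dotp_mxl trmxK.
  by rewrite trmxK; exact: mulmx1C.
have QE z : Q z = Q e * dotp z z.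
  have [->|z0] := eqVneq z 0.
    rewrite [dotp 0 0](_ : _ = 0) ?mulr0; last by apply/eqP; rewrite dotp_eq0.
    rewrite -[RHS](sphere_mean_cst hnu'); apply: eq_sphere_mean => t _.
    by rewrite -(scale0r 0) !dotpE !mul0r.
  have nz : 0 < enorm z by rewrite sqrtr_gt0 dotp_gt0.
  rewrite -(QS ((enorm z)^-1 *: z)); last first.
    by apply/sphereP; rewrite !dotpE -sqr_enorm; field; rewrite gt_eqF.
  rewrite -sqr_enorm mulrC /Q -sphere_meanZ//.
  apply: eq_sphere_mean => t _; rewrite !dotpE; field.
  by rewrite gt_eqF.
exists (Q e).
  apply: (sphere_mean_gt0 (f := fun t => dotp t e * dotp t e) hnu' (t0 := e)) => //.
    by move=> t _; rewrite -expr2 sqr_ge0.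
  by move/sphereP : Se => ->; rewrite mulr1.
move=> x y.
have cZ (a : R) z : continuous (fun t : 'rV[R]_q.+1 => a * (dotp t z * dotp t z)).
  by apply: (continuous_mulr (f := fun=> a)) => //; exact: cst_continuous.
(* Polarization: [uv = ((u + v)^2 - (u - v)^2) / 4]. *)
transitivity (4^-1 * Q (x + y) + - 4^-1 * Q (x - y)); last first.
  by rewrite (QE (x + y)) (QE (x - y)) !dotpE (dotpC y x); field.
rewrite -!sphere_meanZ// -sphere_meanD//.
by apply: eq_sphere_mean => t _; rewrite !dotpE; field.
Qed.

(** * The kernel of the statistics *)

Definition lap_kernel {R : realType} {p : nat}
    (nu : probability (borel_rV R p) R) (l : R) (x y : 'rV[R]_p) : R :=
  sphere_mean nu (fun t => zonal_lap (p%:R - 1) l (dotp t x) *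
                           zonal_lap (p%:R - 1) l (dotp t y)).

Lemma continuous_zonal_lap {R : realType} {T : topologicalType} (d l : R)
    (f : T -> R) :
  continuous f -> continuous (fun t => zonal_lap d l (f t)).
Proof.
move=> cf; have cc (c : R) : continuous (fun _ : T => c) by exact: cst_continuous.
apply: continuous_mulr.
  move=> t; apply: continuous_comp; last exact: continuous_expR.
  by apply: (continuous_mulr (f := fun=> l)).
apply: continuous_subr; last by apply: (continuous_mulr (f := fun=> d * l)).
apply: (continuous_mulr (f := fun=> l ^+ 2)) => //.
by apply: continuous_subr => //; exact: (continuous_mulr cf cf).
Qed.

(** Splits the pairs into the diagonal, those above it and those below it; swapping coordinates
    identifies the last two. Applied to the kernel, it isolates what remains of [T] after [D] is
    subtracted. *)
Lemma sum_pair_sym (V : nmodType) n (F : 'I_n -> 'I_n -> V) :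
  (forall i j, F i j = F j i) ->
  \sum_(i < n) \sum_(j < n) F i j =
  \sum_(i < n) F i i + (\sum_(ij : 'I_n * 'I_n | (ij.1 < ij.2)%N) F ij.1 ij.2) *+ 2.
Proof.
move=> FC; rewrite pair_bigA /= (bigID (fun ij : 'I_n * 'I_n => ij.1 == ij.2)) /=.
congr (_ + _).
  rewrite -(pair_big_dep xpredT (fun i j => i == j) F) /=.
  by apply: eq_bigr => i _; rewrite (big_pred1 i)// => j; rewrite eq_sym.
rewrite (bigID (fun ij : 'I_n * 'I_n => (ij.1 < ij.2)%N)) /= mulr2n.
congr (_ + _).
  apply: eq_bigl => -[i j] /=; rewrite -val_eqE /=.
  by case: ltngtP.
rewrite (reindex_inj (h := fun ij : 'I_n * 'I_n => (ij.2, ij.1))) /=; last first.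
  by move=> [i j] [i' j'] [-> ->].
apply: eq_big => [[i j]|[i j] _] /=; last exact: FC.
by rewrite -val_eqE /=; case: ltngtP.
Qed.

Section Kernel.
Context {R : realType} {p : nat} {nu : probability (borel_rV R p) R}.
Hypothesis hnu : uniform_on_sphere nu.
Local Notation K := (lap_kernel nu).

Lemma continuous_lap_product l x y : continuous (fun t : 'rV[R]_p =>
  zonal_lap (p%:R - 1) l (dotp t x) * zonal_lap (p%:R - 1) l (dotp t y)).
Proof.
by apply: continuous_mulr; apply: continuous_zonal_lap; exact: continuous_dotp.
Qed.

Lemma lap_kernelC l x y : K l x y = K l y x.
Proof. by apply: eq_sphere_mean => t _; rewrite mulrC. Qed.

(** A rotation taking [y] to [x] carries one integrand to the other. *)
Lemma lap_kernel_diag l x y : sphere R p x -> sphere R p y -> K l x x = K l y y.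
Proof.
move=> Sx Sy; have [U UU yU] := sphere_transitive Sy Sx.
rewrite /lap_kernel -[RHS](sphere_mean_mulmx hnu (O := U^T)).
- by apply: eq_sphere_mean => t _; rewrite -yU dotp_mxl trmxK.
- by rewrite trmxK; exact: mulmx1C.
- exact: continuous_lap_product.
Qed.

Lemma sqr_L2_norm (h : 'rV[R]_p -> R) :
  L2_norm nu h ^+ 2 = sphere_mean nu (fun t => h t * h t).
Proof.
by rewrite sqr_sqrtr//; apply: Rintegral_ge0 => t _; rewrite -expr2 sqr_ge0.
Qed.

Lemma sqr_L2_norm_lap_exp l x : sphere R p x ->
  L2_norm nu (lap_exp l x) ^+ 2 = K l x x.
Proof.
by move=> Sx; rewrite sqr_L2_norm; apply: eq_sphere_mean => t St; rewrite lap_expE.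
Qed.

Lemma D_stat_kernel n (l : R) (x : 'I_n -> 'rV[R]_p) :
  (forall j, sphere R p (x j)) ->
  D_stat nu l x = n%:R^-1 * \sum_(j < n) K l (x j) (x j).
Proof.
by move=> Sx; congr (_ * _); apply: eq_bigr => j _; exact: sqr_L2_norm_lap_exp.
Qed.

Lemma T_stat_kernel n (l : R) (x : 'I_n -> 'rV[R]_p) :
  (0 < n)%N -> (forall j, sphere R p (x j)) ->
  T_stat nu l x = n%:R^-1 * \sum_(i < n) \sum_(j < n) K l (x i) (x j).
Proof.
move=> n0 Sx; have nn0 : n%:R != 0 :> R by rewrite pnatr_eq0 -lt0n.
have cK i j := @continuous_lap_product l (x i) (x j).
have cKs i : continuous (fun t : 'rV[R]_p => \sum_(j < n)
    zonal_lap (p%:R - 1) l (dotp t (x i)) * zonal_lap (p%:R - 1) l (dotp t (x j))).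
  exact: continuous_sumr.
rewrite /T_stat sqr_L2_norm.
transitivity (n%:R * (n%:R ^- 2 * \sum_(i < n) \sum_(j < n) K l (x i) (x j))); last first.
  by field.
congr (_ * _).
under [in RHS]eq_bigr do rewrite -(sphere_mean_sum hnu)//.
rewrite -(sphere_mean_sum hnu)// -sphere_meanZ; last exact: continuous_sumr.
apply: eq_sphere_mean => t St; rewrite (eq_bigr _ (fun j _ => lap_expE l (Sx j) St)).
rewrite mulrACA -expr2 exprVn big_distrl /=; congr (_ * _); apply: eq_bigr => i _.
by rewrite big_distrr.
Qed.

Lemma T_sub_D_kernel n (l : R) (x : 'I_n -> 'rV[R]_p) :
  (0 < n)%N -> (forall j, sphere R p (x j)) ->
  T_stat nu l x - D_stat nu l x =
  2 / n%:R * \sum_(ij : 'I_n * 'I_n | (ij.1 < ij.2)%N) K l (x ij.1) (x ij.2).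
Proof.
move=> n0 Sx; rewrite T_stat_kernel// D_stat_kernel//.
rewrite sum_pair_sym => [|i j]; last exact: lap_kernelC.
rewrite mulrDr addrC addKr -mulr_natr; ring.
Qed.

(** All diagonal kernel values agree. Critical values for [T] may therefore include [D] without
    depending on the sample. *)
Lemma D_stat_const n (l : R) (x : 'I_n -> 'rV[R]_p) (e : 'rV[R]_p) :
  (0 < n)%N -> sphere R p e -> (forall j, sphere R p (x j)) ->
  D_stat nu l x = K l e e.
Proof.
move=> n0 Se Sx; rewrite D_stat_kernel//.
rewrite (eq_bigr _ (fun j _ => lap_kernel_diag l (Sx j) Se)).
rewrite sumr_const card_ord -[X in _ * X]mulr_natl mulrA mulVf ?mul1r//.
by rewrite pnatr_eq0 -lt0n.
Qed.

End Kernel.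

(** * Small concentration *)

Section SmallConcentration.
Context {R : realType}.

(** From [1 + u <= e^u] at [u] and [- u]: for [u >= 0] one gets [e^u - 1 <= u e^u], and for [u < 0]
    one gets [1 - e^u <= - u]. *)
Lemma expR_sub1_le (u : R) : `|u| <= 1 -> `|expR u - 1| <= expR 1 * `|u|.
Proof.
rewrite ler_norml => /andP[u1 u2].
have e1 : 1 <= expR 1 :> R by rewrite -[leLHS]expR0 ler_expR.
have h1 := expR_ge1Dx u; have h2 := expR_ge1Dx (- u).
have [u0|u0] := leP 0 u.
  have eu : 1 <= expR u by rewrite -[leLHS]expR0 ler_expR.
  rewrite (ger0_norm u0) ger0_norm ?subr_ge0//.
  have h3 : expR u * (1 - u) <= 1.
    by rewrite -[leRHS](expRxMexpNx_1 u) ler_wpM2l// expR_ge0.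
  have h4 : expR u <= expR 1 by rewrite ler_expR.
  have : u * expR u <= u * expR 1 by rewrite ler_wpM2l.
  lra.
have eu : expR u <= 1 by rewrite -[leRHS]expR0 ler_expR ltW.
rewrite (ltr0_norm u0) ler0_norm ?subr_le0//.
have : (- u) * 1 <= (- u) * expR 1 by rewrite ler_wpM2l// oppr_ge0 ltW.
lra.
Qed.

Lemma zonal_lap_small (d l s : R) : 0 <= d -> 0 < l <= 1 -> `|s| <= 1 ->
  `|zonal_lap d l s + d * l * s| <= (1 + d) * expR 1 * l ^+ 2.
Proof.
move=> d0 /andP[l0 l1] s1.
have ls : `|l * s| <= l by rewrite normrM gtr0_norm// ler_piMr// ltW.
have ls1 : `|l * s| <= 1 := le_trans ls l1.
have el : expR (l * s) <= expR 1.
  by rewrite ler_expR (le_trans (ler_norm _)).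
have s2 : 0 <= 1 - s ^+ 2 <= 1.
  rewrite subr_ge0 gerBl sqr_ge0 andbT -real_normK ?num_real//.
  by rewrite exprn_ile1// normr_ge0.
(* Two errors of order [l^2]: the quadratic part of the polynomial, and the replacement of [e^(l s)]
   by 1 in the linear part. *)
have -> : zonal_lap d l s + d * l * s = expR (l * s) * (l ^+ 2 * (1 - s ^+ 2))
   - d * (l * s) * (expR (l * s) - 1) by rewrite /zonal_lap /zonal_poly; ring.
apply: le_trans (ler_normB _ _) _.
have -> : (1 + d) * expR 1 * l ^+ 2 =
  expR 1 * (l ^+ 2 * 1) + d * l * (expR 1 * l) by ring.
case/andP: s2 => s2 s2'.
have l2 : 0 <= l ^+ 2 by rewrite sqr_ge0.
apply: lerD.
  rewrite ger0_norm; last exact: mulr_ge0 (expR_ge0 _) (mulr_ge0 l2 s2).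
  apply: ler_pM => //.
  - by rewrite mulr_ge0.
  - by rewrite ler_wpM2l.
rewrite normrM normrM (ger0_norm d0); apply: ler_pM => //.
- by rewrite mulr_ge0.
- by rewrite ler_wpM2l.
- by apply: le_trans (expR_sub1_le ls1) _; rewrite ler_wpM2l// expR_ge0.
Qed.

Lemma zonal_lap_product_small (d l s s' : R) : 0 <= d -> 0 < l <= 1 ->
  `|s| <= 1 -> `|s'| <= 1 ->
  `|zonal_lap d l s * zonal_lap d l s' - d ^+ 2 * l ^+ 2 * (s * s')| <=
    ((1 + d) * expR 1) * ((1 + d) * expR 1 + 2 * d) * l ^+ 3.
Proof.
move=> d0 l01 s1 s1'.
have h := zonal_lap_small d0 l01 s1; have h' := zonal_lap_small d0 l01 s1'.
have /andP[l0 l1] := l01.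
set A := (1 + d) * expR 1 in h h' *.
have A0 : 0 <= A by rewrite mulr_ge0 ?expR_ge0 ?addr_ge0.
have ds z : `|z| <= 1 -> `|d * l * z| <= d * l.
  have dl : 0 <= d * l := mulr_ge0 d0 (ltW l0).
  by move=> z1; rewrite normrM (ger0_norm dl) ler_piMr.
have g' : `|zonal_lap d l s'| <= (d + A) * l.
  have -> : zonal_lap d l s' = (zonal_lap d l s' + d * l * s') - d * l * s' by ring.
  apply: le_trans (ler_normB _ _) _.
  have := ds _ s1'.
  have : A * l ^+ 2 <= A * l by rewrite ler_wpM2l// expr2 ler_piMr// ltW.
  lra.
(* The identity [g g' - u u' = (g + u) g' - u (g' + u')] with [u = d l s]: each product pairs an
   error of order [l^2] with a factor of order [l]. *)
have -> : zonal_lap d l s * zonal_lap d l s' - d ^+ 2 * l ^+ 2 * (s * s') =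
   (zonal_lap d l s + d * l * s) * zonal_lap d l s'
   - (d * l * s) * (zonal_lap d l s' + d * l * s') by ring.
apply: le_trans (ler_normB _ _) _.
have -> : A * (A + 2 * d) * l ^+ 3 =
  (A * l ^+ 2) * ((d + A) * l) + (d * l) * (A * l ^+ 2) by ring.
by rewrite (normrM (_ + _)) (normrM (d * l * s));
  apply: lerD; apply: ler_pM => //; exact: ds.
Qed.

End SmallConcentration.

Section KernelSmall.
Context {R : realType} {p : nat} {nu : probability (borel_rV R p) R}.
Hypothesis hnu : uniform_on_sphere nu.

(** The mean under a probability is 1-Lipschitz for the sup distance on the sphere. *)
Lemma sphere_mean_dist (f g : 'rV[R]_p -> R) (M : R) :
  continuous f -> continuous g -> (forall t, sphere R p t -> `|f t - g t| <= M) ->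
  `|sphere_mean nu f - sphere_mean nu g| <= M.
Proof.
move=> cf cg fgM.
have cM : continuous (fun _ : 'rV[R]_p => M) by exact: cst_continuous.
have le h k : continuous h -> continuous k ->
    (forall t, sphere R p t -> h t <= k t + M) ->
    sphere_mean nu h <= sphere_mean nu k + M.
  move=> ch ck hk; rewrite -[leRHS](congr1 (+%R _) (sphere_mean_cst hnu M)).
  by rewrite -sphere_meanD//; apply: le_sphere_mean => //; exact: continuous_addr.
rewrite ler_distl lerBlDr; apply/andP; split; apply: le => // t /fgM.
all: by rewrite ler_distl => /andP[]; lra.
Qed.

Lemma lap_kernel_small : (2 <= p)%N -> exists2 c : R, 0 < c &
  forall x y, sphere R p x -> sphere R p y ->
  l ^- 2 * lap_kernel nu l x y @[l --> (0 : R)^'+] --> c * dotp x y.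
Proof.
move=> p2; have [c c0 cE] := sphere_second_moment hnu (ltnW p2).
pose d : R := p%:R - 1.
have d0 : 0 < d by rewrite subr_gt0 ltr1n.
(* The leading term of the integrand is [d^2 l^2 (t . x) (t . y)]; [d] is positive because
   [2 <= p]. *)
exists (d ^+ 2 * c); first by rewrite mulr_gt0// exprn_gt0.
move=> x y Sx Sy.
pose C := ((1 + d) * expR 1) * ((1 + d) * expR 1 + 2 * d).
have bound l : 0 < l <= 1 ->
    `|lap_kernel nu l x y - l ^+ 2 * (d ^+ 2 * c * dotp x y)| <= C * l ^+ 3.
  move=> l01.
  have cdd : continuous (fun t : 'rV[R]_p => dotp t x * dotp t y).
    by apply: continuous_mulr; exact: continuous_dotp.
  rewrite -mulrA -cE mulrA [l ^+ 2 * _]mulrC -sphere_meanZ//.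
  apply: sphere_mean_dist.
  - exact: continuous_lap_product.
  - by apply: (continuous_mulr (f := fun=> _)) => //; exact: cst_continuous.
  move=> t St; apply: zonal_lap_product_small => //;
    [exact: ltW|exact: dotp_sphere_norm_le1..].
have C0 : 0 <= C.
  have dn := ltW d0; have e1 := expR_ge0 (1 : R).
  by apply: mulr_ge0; [apply: mulr_ge0|apply: addr_ge0; apply: mulr_ge0] => //;
    exact: addr_ge0.
apply/cvgrPdist_le => e e0.
near=> l.
have l0 : 0 < l by near: l; exact: nbhs_right_gt.
have l1 : l <= 1 by near: l; exact: nbhs_right_le.
(* The error after division by [l^2] is at most [C l]; adding 1 keeps the denominator positive. *)
have le : l <= e / (C + 1) by near: l; apply: nbhs_right_le; rewrite divr_gt0// ltr_wpDl.
have := bound l; rewrite l0 l1 => /(_ isT) H.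
rewrite distrC (_ : _ - _ =
    l ^- 2 * (lap_kernel nu l x y - l ^+ 2 * (d ^+ 2 * c * dotp x y))); last first.
  by field; rewrite gt_eqF.
rewrite normrM ger0_norm ?invr_ge0 ?sqr_ge0// mulrC ler_pdivrMr ?exprn_gt0//.
apply: le_trans H _.
rewrite exprS mulrA ler_wpM2r ?sqr_ge0//.
rewrite ler_pdivlMr in le; last by rewrite ltr_wpDl.
by apply: le_trans le; rewrite mulrC ler_wpM2l ?ltW// ltrDl.
Unshelve. all: by end_near.
Qed.

Lemma T_stat_small n : (2 <= p)%N -> (0 < n)%N -> exists2 c : R, 0 < c &
  forall x : 'I_n -> 'rV[R]_p, (forall j, sphere R p (x j)) ->
  l ^- 2 * T_stat nu l x @[l --> (0 : R)^'+] --> c * rayleigh_stat x.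
Proof.
move=> p2 n0; have [c c0 H] := lap_kernel_small p2; exists c => // x Sx.
rewrite (_ : (fun l => _) = (fun l => n%:R^-1 * \sum_(i < n) \sum_(j < n)
    l ^- 2 * lap_kernel nu l (x i) (x j))); last first.
  apply/funext => l; rewrite T_stat_kernel// mulrCA big_distrr /=; congr (_ * _).
  by apply: eq_bigr => i _; rewrite big_distrr.
rewrite /rayleigh_stat mulrCA; apply: cvgM; first exact: cvg_cst.
have cvgs (F : 'I_n -> R -> R) (a : 'I_n -> R) :
    (forall i, F i l @[l --> (0 : R)^'+] --> a i) ->
    (\sum_(i < n) F i l) @[l --> (0 : R)^'+] --> \sum_(i < n) a i.
  move=> Fa; apply: cvg_big; first by move=> ?; exact: add_continuous.
  by move=> i _; exact: Fa.
rewrite big_distrr /=; apply: (cvgs) => i.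
by rewrite big_distrr /=; apply: cvgs => j; exact: H.
Qed.

End KernelSmall.

(** * Large concentration *)

Section LargeConcentration.
Context {R : realType}.

(** With [u = l (b - a)], [e^u >= u^(k+1) / (k+1)!]: one more power of [l] than needed, which
    absorbs [C]. *)
Lemma exp_dominates (C a b : R) (k : nat) : a < b ->
  \forall l \near +oo, C * l ^+ k * expR (l * a) <= expR (l * b).
Proof.
move=> ab; have e0 : 0 < b - a by rewrite subr_gt0.
have f0 : 0 < (k.+1)`!%:R :> R by rewrite ltr0n fact_gt0.
near=> l.
have l0 : 0 < l by near: l; exact: nbhs_pinfty_gt.
have lC : C * (k.+1)`!%:R / (b - a) ^+ k.+1 <= l.
  by near: l; apply: nbhs_pinfty_ge; rewrite num_real.
have -> : l * b = l * (b - a) + l * a by ring.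
rewrite expRD ler_wpM2r ?expR_ge0//.
have lba : 0 <= l * (b - a) by rewrite mulr_ge0// ltW.
apply: le_trans (expR_ge1Dxn k lba).
apply: (@le_trans _ _ ((l * (b - a)) ^+ k.+1 / (k.+1)`!%:R)); last by rewrite lerDr.
rewrite ler_pdivlMr// exprMn.
rewrite ler_pdivrMr ?exprn_gt0// in lC.
rewrite (exprS l) [C * _]mulrC -!mulrA [_ * (l ^+ k * _)]mulrCA ler_wpM2l//.
by rewrite exprn_ge0// ltW.
Unshelve. all: by end_near.
Qed.

Lemma zonal_poly_bound (d l s : R) : 0 <= d -> 1 <= l -> `|s| <= 1 ->
  `|zonal_poly d l s| <= (1 + d) * l ^+ 2.
Proof.
move=> d0 l1; rewrite ler_norml => /andP[s1 s2].
have l0 : 0 <= l ^+ 2 by rewrite sqr_ge0.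
have ll : l <= l ^+ 2 by rewrite expr2 ler_peMr//; lra.
have dl : d * l <= d * l ^+ 2 by rewrite ler_wpM2l.
have dl0 : 0 <= d * l by rewrite mulr_ge0//; lra.
have t0 : 0 <= 1 - s ^+ 2 by nra.
have h1 : 0 <= l ^+ 2 * (1 - s ^+ 2) by rewrite mulr_ge0.
have h2 : l ^+ 2 * (1 - s ^+ 2) <= l ^+ 2 by rewrite ler_piMr// gerBl sqr_ge0.
have h3 : d * l * s <= d * l by rewrite ler_piMr.
have h4 : - (d * l) <= d * l * s by rewrite -mulrN1 ler_wpM2l.
by rewrite ler_norml /zonal_poly; apply/andP; split; lra.
Qed.

(** Only the linear term can be negative, so the negative values are of order [l], not [l^2]. *)
Lemma zonal_poly_ge (d l s : R) : 0 <= d -> 1 <= l -> `|s| <= 1 ->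
  - (d * l) <= zonal_poly d l s.
Proof.
move=> d0 l1; rewrite ler_norml => /andP[s1 s2]; rewrite /zonal_poly.
have h1 : 0 <= l ^+ 2 * (1 - s ^+ 2) by rewrite mulr_ge0 ?sqr_ge0//; nra.
have h2 : d * l * s <= d * l by rewrite ler_piMr// mulr_ge0//; lra.
lra.
Qed.

(** Negativity means [l (1 - s) (1 + s) < d s], which forces [s >= 0]; then [1 + s >= 1] and
    [d s <= d]. As [|t - x|^2 = 2 (1 - s)], this confines [t] to a small cap around the pole. *)
Lemma zonal_poly_lt0 (d l s : R) : 0 <= d -> 1 <= l -> `|s| <= 1 ->
  zonal_poly d l s < 0 -> l * (1 - s) <= d.
Proof.
move=> d0 l1; rewrite ler_norml => /andP[s1 s2]; rewrite /zonal_poly => Ps.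
have l0 : 0 < l by lra.
have {Ps} : l * (l * ((1 - s) * (1 + s)) - d * s) < 0.
  by rewrite (_ : _ * _ = l ^+ 2 * (1 - s ^+ 2) - d * l * s)//; ring.
rewrite pmulr_rlt0// => Ps.
have ls : 0 <= l * (1 - s) by rewrite mulr_ge0//; lra.
have s0 : 0 <= s.
  rewrite leNgt; apply/negP => sn.
  have h1 : 0 <= l * ((1 - s) * (1 + s)) by rewrite !mulr_ge0//; lra.
  have h2 : d * s <= 0 by rewrite mulr_ge0_le0// ltW.
  lra.
have h1 : 0 <= l * (1 - s) * s by rewrite mulr_ge0.
have h2 : d * s <= d by rewrite ler_piMr.
lra.
Qed.

(** Away from the two poles the term [l^2 (1 - s^2)] wins: the threshold on [l] makes [d l] at most
    half of [l^2 a]. *)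
Lemma zonal_poly_large (d l a s : R) : 0 <= d -> 1 <= l ->
  0 < a -> 2 * d / a <= l -> `|s| <= 1 ->
  a <= 1 - s ^+ 2 -> l ^+ 2 * (a / 2) <= zonal_poly d l s.
Proof.
move=> d0 l1 a0; rewrite ler_pdivrMr// ler_norml => la /andP[s1 s2] as2.
rewrite /zonal_poly.
have : l ^+ 2 * a <= l ^+ 2 * (1 - s ^+ 2) by rewrite ler_wpM2l// sqr_ge0.
have : d * l * s <= d * l by rewrite ler_piMr// mulr_ge0//; lra.
have : l * (2 * d) <= l * (l * a) by rewrite ler_wpM2l//; lra.
lra.
Qed.

(** A negative product has exactly one negative factor, of order [l], while the other is of order
    [l^2]. The resulting [l^3] loses against the [l^4] of the positive part. *)
Lemma zonal_poly_product_ge (d l s s' : R) : 0 <= d -> 1 <= l ->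
  `|s| <= 1 -> `|s'| <= 1 ->
  - ((1 + d) ^+ 2 * l ^+ 3) <= zonal_poly d l s * zonal_poly d l s'.
Proof.
move=> d0 l1 s1 s1'.
wlog ss : s s' s1 s1' / zonal_poly d l s <= zonal_poly d l s'.
  move=> H; have [ss|/ltW ss] := leP (zonal_poly d l s) (zonal_poly d l s').
    exact: H.
  by rewrite (mulrC (zonal_poly d l s)); exact: H.
have h1 := zonal_poly_ge d0 l1 s1.
have := zonal_poly_bound d0 l1 s1'; rewrite ler_norml => /andP[_ h2].
have dl : 0 <= d * l by nra.
have l3 : 0 <= (1 + d) ^+ 2 * l ^+ 3 by apply: mulr_ge0; rewrite exprn_ge0//; lra.
have [Ps|Ps] := leP 0 (zonal_poly d l s).
  apply: (@le_trans _ _ 0); first by rewrite oppr_le0.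
  exact: mulr_ge0 Ps (le_trans Ps ss).
have [Ps'|Ps'] := leP (zonal_poly d l s') 0.
  by apply: (@le_trans _ _ 0); [rewrite oppr_le0|rewrite mulr_le0// ltW].
have h3 : - zonal_poly d l s * zonal_poly d l s' <= (d * l) * ((1 + d) * l ^+ 2).
  by apply: ler_pM => //; [lra|exact: ltW|lra].
have h4 : (d * l) * ((1 + d) * l ^+ 2) <= (1 + d) ^+ 2 * l ^+ 3.
  have -> : (1 + d) ^+ 2 * l ^+ 3 =
    (d * l) * ((1 + d) * l ^+ 2) + (1 + d) * l ^+ 3 by ring.
  by rewrite lerDl mulr_ge0// ?exprn_ge0//; lra.
lra.
Qed.

End LargeConcentration.

Section KernelLarge.
Context {R : realType} {p : nat} {nu : probability (borel_rV R p) R}.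
Hypothesis hnu : uniform_on_sphere nu.
Hypothesis p2 : (2 <= p)%N.
Implicit Types x y t : 'rV[R]_p.
Local Notation K := (lap_kernel nu).
Let d : R := p%:R - 1.
Local Notation P := (zonal_poly d).

Let d0 : 0 <= d.
Proof. by rewrite subr_ge0 ler1n ltnW. Qed.

Let zonal_lap_product (l s s' : R) :
  zonal_lap d l s * zonal_lap d l s' = expR (l * (s + s')) * (P l s * P l s').
Proof. by rewrite mulrDr expRD /zonal_lap; ring. Qed.

(** By Cauchy-Schwarz the exponent is at most [l |x + y|]; the gap up to [r] absorbs the polynomial
    factor of order [l^4]. *)
Lemma lap_kernel_upper x y (r : R) : sphere R p x -> sphere R p y ->
  enorm (x + y) < r -> \forall l \near +oo, K l x y <= expR (l * r).
Proof.
move=> Sx Sy xyr.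
have H := @exp_dominates _ ((1 + d) ^+ 2) _ _ 4 xyr.
near=> l.
have l1 : 1 <= l by near: l; exact: nbhs_pinfty_ge.
apply: (@le_trans _ _ ((1 + d) ^+ 2 * l ^+ 4 * expR (l * enorm (x + y))));
  last by near: l.
rewrite -[leRHS](sphere_mean_cst hnu); apply: le_sphere_mean.
- exact: continuous_lap_product.
- exact: cst_continuous.
move=> t St; rewrite zonal_lap_product -dotpDr mulrC.
have b z : sphere R p z -> `|P l (dotp t z)| <= (1 + d) * l ^+ 2.
  by move=> Sz; apply: zonal_poly_bound => //; exact: dotp_sphere_norm_le1.
apply: le_trans (ler_norm _) _; rewrite normrM (ger0_norm (expR_ge0 _)).
apply: ler_pM => //.
  rewrite normrM (_ : _ * l ^+ 4 = ((1 + d) * l ^+ 2) * ((1 + d) * l ^+ 2)); last by ring.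
  by apply: ler_pM => //; exact: b.
rewrite ler_expR ler_wpM2l ?dotp_le_enorm//; lra.
Unshelve. all: by end_near.
Qed.

(** Laplace's method: [psi] localizes the integral to a neighbourhood of [t0] on which
    the integrand is at least of order [l ^+ 4 * expR (l * r)]; where the integrand is
    negative, one of its two factors is only of order [l]. *)
Lemma lap_kernel_lower_local x y t0 (psi : 'rV[R]_p -> R) (a r : R) :
  sphere R p x -> sphere R p y -> sphere R p t0 ->
  continuous psi -> 0 < psi t0 -> 0 < a ->
  (forall t, sphere R p t -> 0 < psi t -> [/\ r <= dotp t x + dotp t y,
     a <= 1 - dotp t x ^+ 2 & a <= 1 - dotp t y ^+ 2]) ->
  (\forall l \near +oo, forall t, sphere R p t ->
     P l (dotp t x) * P l (dotp t y) < 0 -> dotp t x + dotp t y <= r) ->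
  \forall l \near +oo, expR (l * r) <= K l x y.
Proof.
move=> Sx Sy St0 cpsi psi0 a0 Hpsi Hneg.
(* A continuous cutoff with values in [[0, 1]], vanishing where [psi <= 0], whose mean is
   positive. *)
pose phi t := Num.max 0 (Num.min 1 (psi t)).
have cphi : continuous phi.
  move=> t; apply: (@continuous_max _ _ (fun=> 0) (fun t => Num.min 1 (psi t))).
    exact: cst_continuous.
  apply: (@continuous_min _ _ (fun=> 1) psi); first exact: cst_continuous.
  exact: cpsi.
have phi0 : 0 < sphere_mean nu phi.
  apply: (sphere_mean_gt0 hnu cphi (t0 := t0)) => //.
    by move=> t _; rewrite le_max lexx.
  by rewrite lt_max lt_min ltr01 psi0 orbT.
set m := sphere_mean nu phi in phi0.

near=> l.
have l1 : 1 <= l by near: l; exact: nbhs_pinfty_ge.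
have l0 : 0 < l by lra.
have la : 2 * d / a <= l by near: l; apply: nbhs_pinfty_ge; rewrite num_real.
(* Chosen so that [l a^2 m / 4 - (1 + d)^2 >= 1] in the final estimate. *)
have lm : (1 + (1 + d) ^+ 2) * 4 / (a ^+ 2 * m) <= l.
  by near: l; apply: nbhs_pinfty_ge; rewrite num_real.
have neg : forall t, sphere R p t ->
  P l (dotp t x) * P l (dotp t y) < 0 -> dotp t x + dotp t y <= r by near: l.
set E := expR (l * r).
have E0 : 0 < E := expR_gt0 _.
have l3 : 1 <= l ^+ 3 by rewrite exprn_ege1.
have : E * l ^+ 4 * (a ^+ 2 / 4) * m + - (E * ((1 + d) ^+ 2 * l ^+ 3)) <= K l x y.
  rewrite -(sphere_mean_cst hnu (- _)) /m -sphere_meanZ//.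
  have cp : continuous (fun t => E * l ^+ 4 * (a ^+ 2 / 4) * phi t).
    by apply: (continuous_mulr (f := fun=> _)) => //; exact: cst_continuous.
  have cc : continuous (fun _ : 'rV[R]_p => - (E * ((1 + d) ^+ 2 * l ^+ 3))).
    exact: cst_continuous.
  rewrite -sphere_meanD//; apply: le_sphere_mean.
  - exact: continuous_addr.
  - exact: continuous_lap_product.
  move=> t St; rewrite zonal_lap_product.
  have sx := dotp_sphere_norm_le1 St Sx; have sy := dotp_sphere_norm_le1 St Sy.
  have low := zonal_poly_product_ge d0 l1 sx sy.
  set G := P l (dotp t x) * P l (dotp t y) in low *.
  set e := expR _.
  have e0 : 0 < e := expR_gt0 _.
  have D0 : 0 <= (1 + d) ^+ 2 * l ^+ 3 by apply: mulr_ge0; rewrite ?sqr_ge0//; lra.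
  (* Off the cutoff only the error term must be met: where the integrand is negative, [neg] bounds
     its exponential by [E]. Where [psi] is positive, the integrand already exceeds the main
     term. *)
  have [psit|psit] := leP (psi t) 0.
    have -> : phi t = 0.
      by apply/max_idPl; rewrite ge_min psit orbT.
    rewrite mulr0 add0r.
    have [G0|G0] := leP 0 G.
      apply: (@le_trans _ _ 0); last exact: mulr_ge0 (ltW e0) G0.
      by rewrite oppr_le0 mulr_ge0// ltW.
    have eE : e <= E by rewrite ler_expR ler_wpM2l ?neg// ltW.
    apply: (@le_trans _ _ (E * G)); first by rewrite -mulrN ler_wpM2l// ltW.
    by rewrite ler_wnM2r// ltW.
  have [rt ax ay] := Hpsi t St psit.
  have phi1 : phi t <= 1 by rewrite ge_max ler01 ge_min lexx.
  have phi2 : 0 <= phi t by rewrite le_max lexx.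
  have Px : l ^+ 2 * (a / 2) <= P l (dotp t x) by exact: zonal_poly_large.
  have Py : l ^+ 2 * (a / 2) <= P l (dotp t y) by exact: zonal_poly_large.
  have la0 : 0 <= l ^+ 2 * (a / 2) by rewrite mulr_ge0 ?sqr_ge0// divr_ge0// ltW.
  have eE : E <= e by rewrite ler_expR ler_wpM2l// ltW.
  have GE : l ^+ 4 * (a ^+ 2 / 4) <= G.
    rewrite (_ : _ * (a ^+ 2 / 4) = (l ^+ 2 * (a / 2)) * (l ^+ 2 * (a / 2)));
      last by field.
    exact: ler_pM.
  have q0 : 0 <= l ^+ 4 * (a ^+ 2 / 4).
    by rewrite mulr_ge0 ?exprn_ge0 ?divr_ge0 ?sqr_ge0// ltW.
  apply: (@le_trans _ _ (E * (l ^+ 4 * (a ^+ 2 / 4)))).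
    rewrite -[leRHS]addr0; apply: lerD; last by rewrite oppr_le0 mulr_ge0// ltW.
    by rewrite -(mulrA E) ler_piMr// mulr_ge0// ltW.
  by apply: ler_pM => //; exact: ltW.
apply: le_trans.
have am : 0 < a ^+ 2 * m by rewrite mulr_gt0// exprn_gt0.
rewrite ler_pdivrMr// in lm.
have -> : E * l ^+ 4 * (a ^+ 2 / 4) * m + - (E * ((1 + d) ^+ 2 * l ^+ 3)) =
   E * (l ^+ 3 * (l * (a ^+ 2 * m) / 4 - (1 + d) ^+ 2)) by field.
rewrite -[leLHS]mulr1 ler_wpM2l//; first exact: ltW.
rewrite -[leLHS]mulr1; apply: ler_pM => //; lra.
Unshelve. all: by end_near.
Qed.

End KernelLarge.

(** Two squared coordinates with sum at most 1 cannot both reach 1, so some basis vector is not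
    parallel to [x]; its component orthogonal to [x] is normalized. *)
Lemma sphere_orthogonal {R : realType} {p : nat} (x : 'rV[R]_p) :
  (2 <= p)%N -> sphere R p x -> exists2 w, sphere R p w & dotp w x = 0.
Proof.
case: p x => [|[|q]] x // _ /sphereP xx.
have [i xi] : exists i, x 0 i ^+ 2 < 1.
  have [x0|x0] := ltP (x 0 0 ^+ 2) 1; first by exists 0.
  exists (lift ord0 ord0); rewrite -xx /dotp big_ord_recl big_ord_recl /=.
  apply: (@lt_le_trans _ _ (x 0 0 ^+ 2 + x 0 (lift ord0 ord0) ^+ 2)).
    by rewrite ltrDr (lt_le_trans _ x0).
  by rewrite !expr2 addrA lerDl sumr_ge0// => j _; rewrite -expr2 sqr_ge0.
pose v : 'rV[R]_q.+2 := delta_mx 0 i - x 0 i *: x.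
have vv : dotp v v = 1 - x 0 i ^+ 2.
  rewrite !dotpE xx (dotpC (delta_mx 0 i) x) !dotp_delta mxE !eqxx /=; ring.
have v0 : 0 < enorm v by rewrite sqrtr_gt0 vv subr_gt0.
exists ((enorm v)^-1 *: v).
  by apply/sphereP; rewrite dotpZl dotpZr -sqr_enorm; field; rewrite gt_eqF.
by rewrite dotpZl dotpDl dotpNl dotpZl xx dotpC dotp_delta mulr1 subrr mulr0.
Qed.

(** * Exponential lower bounds for the kernel at a pair of points *)

Section PairAsymptotics.
Context {R : realType} {p : nat} {nu : probability (borel_rV R p) R}.
Hypothesis hnu : uniform_on_sphere nu.
Hypothesis p2 : (2 <= p)%N.
Implicit Types x y t : 'rV[R]_p.
Local Notation K := (lap_kernel nu).

Let lower_le x y (r r' : R) : r <= r' ->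
  (\forall l \near +oo, expR (l * r') <= K l x y) ->
  \forall l \near +oo, expR (l * r) <= K l x y.
Proof.
move=> rr' H; near=> l.
have l0 : 0 <= l by near: l; exact: nbhs_pinfty_ge.
apply: (@le_trans _ _ (expR (l * r'))); last by near: l.
by rewrite ler_expR ler_wpM2l.
Unshelve. all: by end_near.
Qed.

Let continuous_1sub_dotp_sqr x (a : R) :
  continuous (fun t : 'rV[R]_p => 1 - dotp t x ^+ 2 - a).
Proof.
have cc (c : R) : continuous (fun _ : 'rV[R]_p => c) by exact: cst_continuous.
apply: continuous_subr => //; apply: continuous_subr => //.
by apply: continuous_mulr; exact: continuous_dotp.
Qed.

Let continuous_dotp_sum x y (r : R) :
  continuous (fun t : 'rV[R]_p => dotp t x + dotp t y - r).
Proof.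
apply: continuous_subr; last exact: cst_continuous.
by apply: continuous_addr; exact: continuous_dotp.
Qed.

Let continuous_minr (f g : 'rV[R]_p -> R) :
  continuous f -> continuous g -> continuous (fun t => Num.min (f t) (g t)).
Proof. by move=> cf cg t; apply: continuous_min; [exact: cf|exact: cg]. Qed.

(** The integrand is a square, so it has no negative part. The exponent peaks at [x], where
    [1 - s^2] vanishes, so the localization is at a nearby point [t0] with [t0 . x = q]. *)
Lemma lap_kernel_lower_eq x (r : R) : sphere R p x -> r < 2 ->
  \forall l \near +oo, expR (l * r) <= K l x x.
Proof.
move=> Sx r2; have [w Sw wx] := sphere_orthogonal p2 Sx.
pose r' := Num.max r 0.
have r'0 : 0 <= r' by rewrite le_max lexx orbT.
have r'2 : r' < 2 by rewrite gt_max r2 ltr0n.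
apply: (@lower_le _ _ _ r'); first by rewrite le_max lexx.
(* The midpoint of [r' / 2] and 1: then [2 q > r'] while [q < 1]. Having [r' >= 0] gives [q >= 0],
   hence [q^2 < 1]. *)
pose q := (r' / 2 + 1) / 2.
have q0 : 0 <= q by rewrite /q; lra.
have q1 : q < 1 by rewrite /q; lra.
have rq : r' < 2 * q by rewrite /q; lra.
have qq : 0 < 1 - q ^+ 2 by nra.
pose t0 := q *: x + Num.sqrt (1 - q ^+ 2) *: w.
have tx : dotp t0 x = q.
  by move/sphereP : Sx => xx; rewrite /t0 !dotpE xx wx; ring.
apply: (@lap_kernel_lower_local _ _ _ hnu p2 x x t0
  (fun t => Num.min (1 - dotp t x ^+ 2 - (1 - q ^+ 2) / 2)
                    (dotp t x + dotp t x - r')) ((1 - q ^+ 2) / 2)) => //.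
- apply/sphereP; move/sphereP : Sx => xx; move/sphereP : Sw => ww.
  rewrite /t0 !dotpE xx ww wx (dotpC x w) wx.
  rewrite (_ : _ + _ = q ^+ 2 + Num.sqrt (1 - q ^+ 2) ^+ 2); last by ring.
  by rewrite sqr_sqrtr ?ltW//; ring.
- by apply: continuous_minr; [exact: continuous_1sub_dotp_sqr|exact: continuous_dotp_sum].
- by rewrite lt_min tx; apply/andP; split; lra.
- by lra.
- by move=> t St; rewrite lt_min => /andP[h1 h2]; split; lra.
near=> l => t St.
by rewrite -expr2 ltNge sqr_ge0.
Unshelve. all: by end_near.
Qed.

(** The exponents at [x] and [- x] cancel, so the integrand never has an exponential larger than 1,
    and localizing near the equator point [w] suffices. *)
Lemma lap_kernel_lower_opp x : sphere R p x ->
  \forall l \near +oo, expR (l * 0) <= K l x (- x).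
Proof.
move=> Sx; have [w Sw wx] := sphere_orthogonal p2 Sx.
have Sx' : sphere R p (- x).
  by apply/sphereP; move/sphereP : Sx => xx; rewrite !dotpE xx opprK.
apply: (@lap_kernel_lower_local _ _ _ hnu p2 x (- x) w
  (fun t => 1 - dotp t x ^+ 2 - 2^-1) 2^-1) => //.
- by rewrite wx; lra.
- by move=> t St h; rewrite dotpNr sqrrN; split; lra.
by near=> l => t St _; rewrite dotpNr subrr.
Unshelve. all: by end_near.
Qed.

Lemma lap_kernel_lower_generic x y (r : R) : sphere R p x -> sphere R p y ->
  -1 < dotp x y < 1 -> r < enorm (x + y) ->
  \forall l \near +oo, expR (l * r) <= K l x y.
Proof.
move=> Sx Sy; set c := dotp x y; move=> /andP[c1 c2] rm.
have xx : dotp x x = 1 by apply/sphereP.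
have yy : dotp y y = 1 by apply/sphereP.
set m := enorm (x + y) in rm.
have m2 : m ^+ 2 = 2 + 2 * c.
  by rewrite sqr_enorm !dotpE xx yy (dotpC y x) -/c; ring.
have m0 : 0 <= m := sqrtr_ge0 _.
have mp : 0 < m by rewrite lt_def m0 andbT -sqrf_eq0 m2 gt_eqF//; lra.
have mlt2 : m < 2 by rewrite ltNge; apply/negP => m_ge2; nra.
(* Since [1 + c = m^2 / 2] and [0 < m < 2]. The level [r'] is then placed between the exponent at
   the poles and the maximal one. *)
have mm : 1 + c < m by nra.
pose r' := Num.max r ((m + (1 + c)) / 2).
have r'm : r' < m by rewrite gt_max rm /=; lra.
have r'c : 1 + c < r' by rewrite lt_max; apply/orP; right; lra.
apply: (@lower_le _ _ _ r'); first by rewrite le_max lexx.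
(* The maximizer of [t . (x + y)] on the sphere; both inner products there are [m / 2 < 1], so it is
   away from the poles. *)
pose t0 := m^-1 *: (x + y).
have tx : dotp t0 x = m / 2.
  rewrite !dotpE xx (dotpC y x) -/c (_ : 1 + c = m ^+ 2 / 2); last by rewrite m2; field.
  by field; rewrite gt_eqF.
have ty : dotp t0 y = m / 2.
  rewrite !dotpE yy -/c (_ : c + 1 = m ^+ 2 / 2); last by rewrite m2; field.
  by field; rewrite gt_eqF.
have mb : (m / 2) ^+ 2 < 1 by nra.
pose a := (1 - (m / 2) ^+ 2) / 2.
have a0 : 0 < a by rewrite /a; lra.
have e0 : 0 < r' - (1 + c) by lra.
pose d : R := p%:R - 1.
have d0 : 0 <= d by rewrite subr_ge0 ler1n ltnW.
apply: (@lap_kernel_lower_local _ _ _ hnu p2 x y t0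
  (fun t => Num.min (Num.min (1 - dotp t x ^+ 2 - a) (1 - dotp t y ^+ 2 - a))
                    (dotp t x + dotp t y - r')) a) => //.
- apply/sphereP; rewrite /t0 dotpZl dotpZr -sqr_enorm -/m.
  by field; rewrite gt_eqF.
- apply: continuous_minr; last exact: continuous_dotp_sum.
  by apply: continuous_minr; exact: continuous_1sub_dotp_sqr.
- rewrite !lt_min tx ty; apply/andP; split; last lra.
  by apply/andP; split; rewrite /a; lra.
- by move=> t St; rewrite !lt_min => /andP[/andP[h1 h2] h3]; split; lra.
near=> l.
have l1 : 1 <= l by near: l; exact: nbhs_pinfty_ge.
have ld : 2 * d / (r' - (1 + c)) ^+ 2 <= l.
  by near: l; apply: nbhs_pinfty_ge; rewrite num_real.
rewrite ler_pdivrMr ?exprn_gt0// in ld.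
(* The integrand is negative only near [x] or [y], where the exponent is about
   [l * (1 + c)] and [1 + c < m]. *)
have near_pole u v t : sphere R p u -> sphere R p v -> dotp u v = c ->
    sphere R p t -> zonal_poly d l (dotp t u) < 0 -> dotp t u + dotp t v <= r'.
  move=> Su Sv uv St neg.
  have tu := dotp_sphere_norm_le1 St Su.
  have h := zonal_poly_lt0 d0 l1 tu neg.
  have tt : dotp t t = 1 by apply/sphereP.
  have uu : dotp u u = 1 by apply/sphereP.
  have vv : dotp v v = 1 by apply/sphereP.
  (* Gives [(t . v - c)^2 <= 2 (1 - t . u)], which is at most [2 d / l] in the cap; the threshold
     [ld] contradicts an excess over [r' - (1 + c)]. *)
  have cs := dotp_CS (t - u) v.
  rewrite !dotpE tt uu vv uv (dotpC u t) in cs.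
  have tu1 : dotp t u <= 1 by apply: le_trans (ler_norm _) _.
  suff : dotp t v - c <= r' - (1 + c) by lra.
  rewrite leNgt; apply/negP => big.
  have sq : (r' - (1 + c)) ^+ 2 < (dotp t v - c) ^+ 2.
    by rewrite ltr_pXn2r// ?nnegrE; lra.
  have : l * (r' - (1 + c)) ^+ 2 < l * (2 * (1 - dotp t u)).
    by rewrite ltr_pM2l; lra.
  lra.
move=> t St.
have [Px|Px] := ltP (zonal_poly d l (dotp t x)) 0.
  by move=> _; apply: near_pole.
have [Py|Py] := ltP (zonal_poly d l (dotp t y)) 0.
  by move=> _; rewrite addrC; apply: near_pole => //; rewrite dotpC.
by rewrite ltNge mulr_ge0.
Unshelve. all: by end_near.
Qed.

(** Equal, antipodal and generic pairs are treated apart; for antipodal ones [|x + y| = 0], so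
    [r < 0] and the bound at exponent 0 suffices. *)
Lemma lap_kernel_lower x y (r : R) : sphere R p x -> sphere R p y ->
  r < enorm (x + y) -> \forall l \near +oo, expR (l * r) <= K l x y.
Proof.
move=> Sx Sy rxy.
have /sphereP xx := Sx; have /sphereP yy := Sy.
have Sy' : sphere R p (- y) by apply/sphereP; rewrite !dotpE yy opprK.
have := dotp_sphere_norm_le1 Sx Sy; rewrite ler_norml => /andP[c1 c2].
have [c2'|c2'] := ltP (dotp x y) 1; last first.
  have xy : x = y by apply: sphere_eq => //; apply/eqP; rewrite eq_le c2 c2'.
  rewrite -xy in rxy *; apply: lap_kernel_lower_eq => //; apply: lt_le_trans rxy _.
  rewrite /enorm !dotpE xx -[leRHS]ger0_norm// -sqrtr_sqr ler_wsqrtr//.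
  lra.
have [c1'|c1'] := ltP (-1) (dotp x y).
  by apply: lap_kernel_lower_generic => //; rewrite c1'.
have xy : x = - y.
  apply: sphere_eq => //; rewrite dotpNr; apply/eqP; rewrite eqr_oppLR.
  by rewrite eq_le c1 c1'.
have -> : y = - x by rewrite xy opprK.
apply: (@lower_le _ _ _ 0); last exact: lap_kernel_lower_opp.
apply/ltW/(lt_le_trans rxy).
by rewrite xy addNr /enorm -(scale0r 0) !dotpE !mul0r sqrtr0.
Qed.

End PairAsymptotics.

(** * From pairs to samples: the growth rate of [T - D] *)

Section Assembly.
Context {R : realType} {p n : nat} {nu : probability (borel_rV R p) R}.
Hypothesis hnu : uniform_on_sphere nu.
Hypotheses (p2 : (2 <= p)%N) (n2 : (2 <= n)%N).
Variable x : 'I_n -> 'rV[R]_p.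
Hypothesis Sx : forall j, sphere R p (x j).
Local Notation M := (max_norm_sum x).
Local Notation TD l := (T_stat nu l x - D_stat nu l x).

Let n0 : (0 < n)%N := ltnW n2.

(** The map [s |-> sqrt (2 + 2 s)] is nondecreasing, hence commutes with maxima, and it sends the
    default value -1 to the default value 0. *)
Lemma max_norm_sum_cai : M = Num.sqrt (2 + 2 * cai_stat x).
Proof.
rewrite /max_norm_sum /cai_stat.
rewrite (big_morph (fun s : R => Num.sqrt (2 + 2 * s)) (id1 := 0) (op1 := Num.max)).
- apply: eq_bigr => -[i j] _ /=; rewrite /enorm !dotpE.
  have /sphereP -> := Sx i; have /sphereP -> := Sx j.
  by rewrite (dotpC (x j)); congr Num.sqrt; ring.
- move=> s s'; have mono (u v : R) : u <= v ->
      Num.sqrt (2 + 2 * u) <= Num.sqrt (2 + 2 * v).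
    by move=> uv; rewrite ler_wsqrtr//; lra.
  by have [ss|/ltW ss] := leP s s';
    rewrite ?(max_idPr (mono _ _ ss)) ?(max_idPl (mono _ _ ss)).
- by rewrite mulrN1 subrr sqrtr0.
Qed.

(** One pair with norm above [r'] already gives the growth; the kernel at every other pair is
    eventually nonnegative. The gap between [r] and [r'] absorbs the factor [n / 2]. *)
Lemma lap_pair_sum_lower (r : R) : r < M -> \forall l \near +oo, expR (l * r) <= TD l.
Proof.
move=> rM; pose r' := (r + M) / 2.
have rr' : r < r' by rewrite /r'; lra.
have r'M : r' < M by rewrite /r'; lra.
have [[i j] /= ij rij] : exists2 ij : 'I_n * 'I_n,
    (ij.1 < ij.2)%N & r' < enorm (x ij.1 + x ij.2).
  (* If [r'] is only below the default value 0, any pair will do, and [2 <= n] provides one. *)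
  move/bigmax_gtP : r'M => [r'0|//].
  exists (Ordinal n0, Ordinal n2) => //.
  exact: lt_le_trans r'0 (sqrtr_ge0 _).
have K0 : \forall l \near +oo, forall ij : 'I_n * 'I_n,
    0 <= lap_kernel nu l (x ij.1) (x ij.2).
  apply: filter_forall => -[a b] /=.
  have lt1 : enorm (x a + x b) - 1 < enorm (x a + x b) by rewrite ltrBlDr ltrDl.
  near=> l; apply: (@le_trans _ _ (expR (l * (enorm (x a + x b) - 1)))).
    exact: expR_ge0.
  by near: l; exact: lap_kernel_lower.
have Kij := lap_kernel_lower hnu p2 (Sx i) (Sx j) rij.
have dom := @exp_dominates _ (n%:R / 2) _ _ 0 rr'.
have nn : 0 < n%:R :> R by rewrite ltr0n.
near=> l.
rewrite (T_sub_D_kernel hnu)// -(ler_pM2l (x := n%:R / 2)) ?divr_gt0//.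
rewrite mulrA (_ : n%:R / 2 * (2 / n%:R) = 1) ?mul1r; last by field; rewrite gt_eqF.
apply: (@le_trans _ _ (expR (l * r'))).
  by have : n%:R / 2 * l ^+ 0 * expR (l * r) <= expR (l * r');
    [near: l|rewrite expr0 mulr1].
rewrite (bigD1 (i, j))//= -[leLHS]addr0 lerD//; first by near: l.
apply: sumr_ge0 => ab _; move: ab.
by near: l.
Unshelve. all: by end_near.
Qed.

(** Every pair is eventually below [expR (l * r')]; the gap between [r'] and [r] absorbs the number
    of pairs. *)
Lemma lap_pair_sum_upper (r : R) : M < r -> \forall l \near +oo, TD l <= expR (l * r).
Proof.
move=> Mr; pose r' := (r + M) / 2.
have r'r : r' < r by rewrite /r'; lra.
have Mr' : M < r' by rewrite /r'; lra.
pose N : R := \sum_(ij : 'I_n * 'I_n | (ij.1 < ij.2)%N) 1.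
have KU : \forall l \near +oo, forall ij : 'I_n * 'I_n, (ij.1 < ij.2)%N ->
    lap_kernel nu l (x ij.1) (x ij.2) <= expR (l * r').
  apply: filter_forall => -[a b] /=.
  have [ab|ab] := boolP (a < b)%N; last by near=> l.
  have abr' : enorm (x a + x b) < r'.
    by move/bigmax_ltP : Mr' => [_ /(_ (a, b) ab)].
  by near=> l => _; near: l; exact: lap_kernel_upper.
have dom := @exp_dominates _ (2 / n%:R * N) _ _ 0 r'r.
near=> l.
rewrite (T_sub_D_kernel hnu)//.
apply: (@le_trans _ _ (2 / n%:R * N * l ^+ 0 * expR (l * r'))); last by near: l.
rewrite expr0 mulr1 -[leRHS]mulrA ler_wpM2l ?divr_ge0//.
rewrite /N mulr_suml; apply: ler_sum => ij ijlt; rewrite mul1r; move: ij ijlt.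
by near: l.
Unshelve. all: by end_near.
Qed.

Lemma T_sub_D_gt0 : \forall l \near +oo, 0 < TD l.
Proof.
have M1 : M - 1 < M by rewrite ltrBlDr ltrDl.
near=> l; apply: (@lt_le_trans _ _ (expR (l * (M - 1)))); first exact: expR_gt0.
by near: l; exact: lap_pair_sum_lower.
Unshelve. all: by end_near.
Qed.

Lemma ln_T_sub_D_cvg : l^-1 * ln (TD l) @[l --> +oo_R] --> M.
Proof.
apply/cvgrPdist_le => e e0.
have M1 : M - e < M by rewrite ltrBlDr ltrDl.
have M2 : M < M + e by rewrite ltrDl.
near=> l.
have l0 : 0 < l by near: l; exact: nbhs_pinfty_gt.
have h1 : expR (l * (M - e)) <= TD l by near: l; exact: lap_pair_sum_lower.
have h2 : TD l <= expR (l * (M + e)) by near: l; exact: lap_pair_sum_upper.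
have td0 : 0 < TD l := lt_le_trans (expR_gt0 _) h1.
rewrite -ler_ln ?posrE ?expR_gt0// expRK in h1.
rewrite -ler_ln ?posrE ?expR_gt0// expRK in h2.
rewrite distrC ler_distl -(ler_pM2l l0) -[X in _ && X](ler_pM2l l0).
by rewrite mulVKf ?gt_eqF// h1.
Unshelve. all: by end_near.
Qed.

End Assembly.

(** * Asymptotic equivalence of the rejection rules *)

Lemma rejection_equiv_large {R : realType} {p n : nat}
    (nu : probability (borel_rV R p) R) :
  (2 <= p)%N -> (2 <= n)%N -> uniform_on_sphere nu ->
  rejection_equiv (+oo_R : set_system R) (@T_stat R p n nu) (@cai_stat R p n).
Proof.
move=> p2 n2 hnu k.
have [e Se] : exists e, sphere R p e.
  case: p p2 {nu hnu} => // q _; exists (delta_mx 0 0).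
  by apply/sphereP; rewrite dotp_delta mxE !eqxx.
have Dk l (x : 'I_n -> 'rV[R]_p) : (forall j, sphere R p (x j)) ->
    D_stat nu l x = lap_kernel nu l e e.
  by move=> Sx; exact: (D_stat_const hnu l (ltnW n2) Se Sx).
(* For [k <= -1] every sample off the boundary rejects, and the critical value [D] works because
   [T - D] is eventually positive. *)
have [k1|k1] := ltP (-1) k; last first.
  exists (fun l => lap_kernel nu l e e) => x Sx xk.
  have kx : k < cai_stat x.
    by rewrite lt_neqAle eq_sym (introN eqP xk)/= (le_trans k1)// bigmax_ge_id.
  near=> l; rewrite kx -(Dk _ x)// -subr_gt0.
  by near: l; exact: T_sub_D_gt0.
(* Comparing [T] with this value compares [T - D], of growth rate [sqrt (2 + 2 cai_stat x)], with an
   exponential of rate [sqrt (2 + 2 k)]. *)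
exists (fun l => lap_kernel nu l e e + expR (l * Num.sqrt (2 + 2 * k))) => x Sx xk.
have k0 : 0 < 2 + 2 * k by lra.
have [kx|xk'] := ltP k (cai_stat x).
  have kM : Num.sqrt (2 + 2 * k) < max_norm_sum x.
    by rewrite (max_norm_sum_cai Sx) ltr_sqrt; lra.
  pose r := (Num.sqrt (2 + 2 * k) + max_norm_sum x) / 2.
  have rM : r < max_norm_sum x by rewrite /r; lra.
  have kr : Num.sqrt (2 + 2 * k) < r by rewrite /r; lra.
  near=> l.
  have l0 : 0 < l by near: l; exact: nbhs_pinfty_gt.
  rewrite -(Dk _ x)// addrC -ltrBrDr.
  apply: (@lt_le_trans _ _ (expR (l * r))); first by rewrite ltr_expR ltr_pM2l.
  by near: l; exact: lap_pair_sum_lower.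
have {}xk : cai_stat x < k by rewrite lt_neqAle (introN eqP xk).
have kM : max_norm_sum x < Num.sqrt (2 + 2 * k).
  by rewrite (max_norm_sum_cai Sx) ltr_sqrt//; lra.
near=> l.
apply/negbTE; rewrite -leNgt -(Dk _ x)// addrC -lerBlDr.
by near: l; exact: lap_pair_sum_upper.
Unshelve. all: by end_near.
Qed.

Lemma rejection_equiv_of_cvg {R : realType} {p n : nat} (F : set_system R)
    (FF : Filter F) (T : R -> ('I_n -> 'rV[R]_p) -> R) (S : ('I_n -> 'rV[R]_p) -> R)
    (c : R) (s : R -> R) :
  0 < c -> (\forall l \near F, 0 < s l) ->
  (forall x, (forall j, sphere R p (x j)) ->
     (s l)^-1 * T l x @[l --> F] --> c * S x) ->
  rejection_equiv F T S.
Proof.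
(* The rescaled statistic tends to [c * S x], which differs from [c * k], so it eventually stays on
   the same side of [c * k] as its limit. *)
move=> c0 s0 TS k; exists (fun l => s l * (c * k)) => x Sx xk.
have cvgT := TS x Sx.
have [kx|xk'] := ltP k (S x).
  have ck : c * k < c * S x by rewrite ltr_pM2l.
  near=> l.
  have sl : 0 < s l by near: l.
  rewrite mulrC -ltr_pdivlMr// [_ / s l]mulrC.
  by near: l; apply: (cvgr_gt _ cvgT).
have {}xk : S x < k by rewrite lt_neqAle (introN eqP xk).
have ck : c * S x < c * k by rewrite ltr_pM2l.
near=> l.
have sl : 0 < s l by near: l.
apply/negbTE; rewrite -leNgt [s l * _]mulrC -ler_pdivrMr// [_ / s l]mulrC ltW//.
by near: l; apply: (cvgr_lt _ cvgT).
Unshelve. all: by end_near.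
Qed.

Unset Implicit Arguments.

Theorem proposition4p1 (R : realType) (p n : nat)
    (hp : (2 <= p)%N) (hn : (2 <= n)%N)
    (nu : probability (borel_rV R p) R) (hnu : uniform_on_sphere nu) :
  (rejection_equiv (0^'+ : set_system R)
     (@T_stat R p n nu) (@rayleigh_stat R p n) /\
   exists2 c : R, 0 < c &
     forall (d : measure_display) (Omega : measurableType d)
       (P : probability Omega R) (X : 'I_n -> {RV P >-> borel_rV R p}),
       iid_on_sphere X ->
       forall w : Omega,
         (l ^- 2 * T_stat nu l (fun j => X j w)) @[l --> (0 : R)^'+] -->
           c * rayleigh_stat (fun j => X j w)) /\
  (rejection_equiv (+oo_R : set_system R)
     (@T_stat R p n nu) (@cai_stat R p n) /\
   forall (d : measure_display) (Omega : measurableType d)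
     (P : probability Omega R) (X : 'I_n -> {RV P >-> borel_rV R p}),
     iid_on_sphere X ->
     forall w : Omega,
       (\forall l \near +oo_R,
          0 < T_stat nu l (fun j => X j w) - D_stat nu l (fun j => X j w)) /\
       (l^-1 * ln (T_stat nu l (fun j => X j w) -
                   D_stat nu l (fun j => X j w))) @[l --> +oo_R] -->
         max_norm_sum (fun j => X j w)).
Proof.
have [c c0 smallT] := T_stat_small hnu (n := n) hp (ltnW hn).
split; split.
- apply: (rejection_equiv_of_cvg (s := fun l => l ^+ 2) _ c0) smallT.
  by near=> l; rewrite exprn_gt0//; near: l; exact: nbhs_right_gt.
- by exists c => // d Omega P X [SX _ _] w; apply: smallT => j; exact: SX.
- exact: rejection_equiv_large.
move=> d Omega P X [SX _ _] w; have Sw j : sphere R p (X j w) by exact: SX.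
split; first exact: T_sub_D_gt0.
exact: ln_T_sub_D_cvg.
Unshelve. all: by end_near.
Qed.
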